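(* Let $p$ be a prime, let $G$ be a finite group and let $P$ be a Sylow $p$-subgroup of $G$. Assume that $O_{p'}(G)=1$ and $|P|\geq p^2$. If every subgroup of $P$ of order $p^2$ satisfies the partial $\Pi$-property in $G$, then $P=O_p(G)$ and $G=P\rtimes H$ is the semidirect product of $P$ and $H$, where $H$ is a Hall $p'$-subgroup of $G$, and one of the following statements holds: (1) $G$ is $p$-supersoluble; (2) $P$ is a minimal normal subgroup of $G$ of order $p^2$; (3) $|P|\geq p^4$ and $H$ is cyclic; furthermore, $P=V_1\times\cdots\times V_s$ with $s\geq 2$, where $V_1,\dots,V_s$ are pairwise $H$-isomorphic irreducible $\mathbb{F}_p[H]$-modules, each of dimension $2$ over $\mathbb{F}_p$.
   Context: All groups are finite. For a group $K$, $\pi(K)$ is the set of primes dividing $|K|$; for a set $\pi$ of primes, a $\pi$-number is a positive integer all of whose prime divisors lie in $\pi$ (so the only $\emptyset$-number is $1$). A subgroup $H$ of a group $G$ satisfies the partial $\Pi$-property in $G$ if there exists a chief series $1=G_0<G_1<\cdots<G_n=G$ of $G$ such that, for every $1\leq i\leq n$, the index $\left|G/G_{i-1}:N_{G/G_{i-1}}\big((HG_{i-1}/G_{i-1})\cap(G_i/G_{i-1})\big)\right|$ is a $\pi\big((HG_{i-1}/G_{i-1})\cap(G_i/G_{i-1})\big)$-number. A group $G$ is $p$-supersoluble if every chief factor of $G$ of order divisible by $p$ is cyclic (i.e. of order $p$). $O_{p'}(G)$ and $O_p(G)$ are the largest normal $p'$-subgroup and the largest normal $p$-subgroup of $G$.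 $\mathbb{F}_p$ is the field with $p$ elements; an $H$-invariant elementary abelian subgroup of $P$ is regarded as an $\mathbb{F}_p[H]$-module via the conjugation action of $H$; $H$-isomorphic means isomorphic as $\mathbb{F}_p[H]$-modules. *)

(* Defs.v *)
From mathcomp Require Import all_boot all_order all_algebra all_fingroup.
From mathcomp Require Import all_solvable all_character.

Set Implicit Arguments.
Unset Strict Implicit.
Unset Printing Implicit Defensive.

Local Open Scope group_scope.

(* The chief series is 1 = G_0 < G_1 < ... < G_n = G with s = [G_1; ...; G_n], *)
(* so that V = G_i and U = G_(i+1) for i < n.  H need not contain V: the       *)
(* subgroup HV / V of G / V is the quotient of the product set H * V.          *)
Definition partial_Pi (gT : finGroupType) (H G : {group gT}) : Prop :=
  exists s : seq {group gT},
    [/\ (G.-chief).-series 1%G s,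
        last 1%G s = G
      & forall i : nat, i < size s ->
          let V := nth 1%G (1%G :: s) i in
          let U := nth 1%G s i in
          let A := ((H * V) / V) :&: (U / V) in
          \pi(A).-nat #|G / V : 'N_(G / V)(A)| ].

Definition p_supersoluble (p : nat) (gT : finGroupType) (G : {group gT}) : Prop :=
  forall V U : {group gT},
    chief_factor G V U -> p %| #|U / V| -> cyclic (U / V).

(* Main.v *)
From HB Require Import structures.
Require Import Defs.
From mathcomp Require Import all_boot all_order all_algebra all_fingroup.
From mathcomp Require Import all_solvable all_character finfield.

(** The proof rests on one observation ([partial_Pi_hit]).  Let K be a subgroup
of P with the partial Pi-property and x a nontrivial element of K, and let
U / V be the factor of the chief series of K with x in U but not in V.  The
normaliser of A = V (K :&: U) has p-power index, so that G = N_G(A) P and the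
G-conjugates of A are P-conjugates.  They all lie in V (P :&: U), whose core is
thus larger than V, hence is U, and U / V is a p-group.  If moreover P normalises
A, then A is normal in G, hence A = U.  Minimal normal subgroups of G are
therefore p-groups, and taking K normal in P inside one of them shows that its
order is p or p ^ 2.  The proof splits accordingly.

Suppose first that G has a normal subgroup of order p.  Let B be generated by
the commutators and the (p - 1)-th powers of G, and let Y be generated by the
p'-elements of B: B centralises every chief factor of order p, hence Y
centralises every normal p-subgroup all of whose chief factors have order p.
A minimal counterexample argument ([cent_small_elt]) shows that Y centralises
every element of P of order dividing p ^ 2: a normal subgroup T of G, minimal
subject to containing an offending element, is a p-group of exponent dividing
p ^ 2, by the existence of characteristic subgroups of small exponent which control the
action of p'-elements ([char_subgroup_exponent_p2]), and then the observation
above, applied to an element of T fixed by P modulo 'C_T(Y), makes T over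
'C_T(Y) of order p.  By a theorem of Ito type ([Ito_pgroup], proved by the
fusion argument of Frobenius and the transfer) Y is a p-group, so B is one.
Then P = B, and G / P is abelian of exponent dividing p - 1; such a group acts
by scalars on its irreducible modules over 'F_p, so G is p-supersoluble.

Suppose now that G has no normal subgroup of order p.  All minimal normal
subgroups have order p ^ 2.  A chief factor U / V of that order has no proper
nontrivial subgroup whose normaliser has p-power index ([chief_p2_subgroup]),
so a subgroup K of order p ^ 2 which meets the socle complements V in U for some
chief factor U / V ([gsocle_hit]).  It follows that elements of order p lie in
the socle and that there are no elements of order p ^ 2: P is the socle, and it
is elementary abelian.  Finally let V1 and V2 be distinct minimal normal
subgroups and K = <a, b> with a in V1 and b in V2.  The resulting V satisfies
V V1 = V V2 and meets V1 V2 in the graph of a G-isomorphism from V1 to V2, which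
does not send a into <b> because V meets K trivially
([minnormal_embedding]).  The freedom in the choice of b provides a
G-endomorphism of V1 which is not a scalar; a complement H of P commutes with
it, so H is abelian, and being faithful and irreducible on V1 it is cyclic
([complement_cyclic]). *)

Set Implicit Arguments.
Unset Strict Implicit.
Unset Printing Implicit Defensive.

Local Open Scope group_scope.

(** * Subgroups of small exponent in p-groups *)

Section SmallExponent.

Variables (p : nat) (gT : finGroupType).
Implicit Types (T H K Q : {group gT}).

Lemma dvdn_bin2_sqr : prime p -> p %| 'C(p ^ 2, 2).
Proof.
move=> p_pr; have [->|odd_p] := even_prime p_pr; first by [].
by rewrite bin2odd ?oddX ?odd_p ?orbT // -mulnA dvdn_mulr.
Qed.

(** The critical subgroup H has class at most 2 and p-th powers in its centre, so
commutators have order dividing p, and p divides the binomial coefficient of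
p ^ 2 and 2 even when p = 2.  This is why p ^ 2, and not p, is the exponent for
which both parities of p can be treated alike. *)
Lemma critical_expMg T H x y : prime p -> p.-group T -> critical H T ->
  x \in H -> y \in H -> (x * y) ^+ (p ^ 2) = x ^+ (p ^ 2) * y ^+ (p ^ 2).
Proof.
move=> p_pr pT cH Hx Hy; have [/andP[sHT _] sPhiZ _ _] := cH.
have pH := pgroupS sHT pT.
have sH1Z: H^`(1) \subset 'Z(H).
  by apply: subset_trans sPhiZ; rewrite (Phi_joing pH) joing_subl.
have /centerP[_ cZ]: [~ y, x] \in 'Z(H) by rewrite (subsetP sH1Z) ?mem_commg.
have Zyp: y ^+ p \in 'Z(H).
  rewrite (subsetP sPhiZ) // (Phi_joing pH) (subsetP (joing_subr _ _)) //.
  by rewrite -[p]expn1 Mho_p_elt ?(mem_p_elt pH).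
have zp1: [~ y, x] ^+ p = 1.
  rewrite -commXg; last by apply: commute_sym; apply: cZ.
  by apply/eqP/commgP; case/centerP: Zyp => _; apply.
rewrite expMg_Rmul; try by apply: commute_sym; apply: cZ.
have /dvdnP[k ->] := dvdn_bin2_sqr p_pr.
by rewrite (mulnC k) [[~ y, x] ^+ _]expgM zp1 expg1n mulg1.
Qed.

(** If u = [~ x, a] commutes with a, then [~ x, a ^+ n] = u ^+ n, so the order of
u divides both that of K and that of a. *)
Lemma coprime_cent_commg K Q : Q \subset 'N(K) -> coprime #|K| #|Q| ->
  [~: K, Q] \subset 'C(Q) -> Q \subset 'C(K).
Proof.
move=> nKQ coKQ cKQQ; rewrite centsC; apply/centsP=> x Kx a Qa; apply/commgP.
have Kxa: [~ x, a] \in K by rewrite groupM ?groupV ?memJ_norm ?(subsetP nKQ).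
have cxa: commute a [~ x, a].
  by apply: commute_sym; apply: (centsP cKQQ); rewrite ?mem_commg.
rewrite -order_eq1 -[#[_]]gcdnn -/(coprime _ _) (coprime_dvdl (order_dvdG Kxa)) //.
apply: coprime_dvdr coKQ; apply: dvdn_trans (order_dvdG Qa).
by rewrite order_dvdn -commgX // expg_order commg1.
Qed.

(** D consists of the elements of order dividing p ^ 2 of a Thompson critical
subgroup H.  A p'-group Q which centralises D centralises the centre of H,
since a coprime action on an abelian group is seen on its elements of order p;
then for x in H the commutator of x with an element of Q has order dividing
p ^ 2, because x ^+ p is central, so it lies in D, and Q centralises H.
The three subgroup lemma extends this to T. *)
Lemma char_subgroup_exponent_p2 T : prime p -> p.-group T ->
  exists D : {group gT},
   [/\ D \char T, {in D, forall x, x ^+ (p ^ 2) = 1}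
     & forall Q, p^'.-group Q -> Q \subset 'N(T) -> Q \subset 'C(D) ->
         Q \subset 'C(T)].
Proof.
move=> p_pr pT; have [H cH] := Thompson_critical pT.
have [chHT sPhiZ sTHZ cTH] := cH; have sHT := char_sub chHT.
have pH := pgroupS sHT pT.
have gD: group_set 'Ldiv_(p ^ 2)(H).
  apply/group_setP; split=> [|x y]; first by rewrite !inE group1 expg1n /=.
  case/LdivP=> Hx x1 /LdivP[Hy y1].
  by rewrite !inE groupM ?(critical_expMg p_pr pT cH) // x1 y1 mulg1 /=.
pose D := Group gD.
have defD: D :=: 'Ohm_2(H) by rewrite (OhmE 2 pH) -[RHS]/<<D>> genGid.
exists D; split=> [||Q p'Q nTQ cDQ].
- by rewrite /= defD (char_trans (Ohm_char _ _)).
- by move=> x /LdivP[].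
have inD x: x \in H -> x ^+ (p ^ 2) = 1 -> x \in D.
  by move=> Hx x1; rewrite !inE Hx x1 /=.
have nHQ: Q \subset 'N(H) := char_norm_trans chHT nTQ.
have coTQ (K : {group gT}): K \subset T -> coprime #|K| #|Q|.
  by move=> sKT; apply: pnat_coprime (pgroupS sKT pT) p'Q.
have comm1 (K : {group gT}): K \subset T -> Q \subset 'N(K) ->
  [~: K, Q] \subset 'C(Q) -> Q \subset 'C(K).
  by move=> sKT nKQ; apply: coprime_cent_commg (coTQ K sKT).
have sZH: 'Z(H) \subset H := center_sub H.
have sZT := subset_trans sZH sHT.
have nZQ: Q \subset 'N('Z(H)) := char_norm_trans (center_char H) nHQ.
have cZQ: Q \subset 'C('Z(H)).
  have tiZ := coprime_abel_cent_TI nZQ (coTQ _ sZT) (center_abelian _).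
  have sRZ: [~: 'Z(H), Q] \subset 'Z(H) by rewrite commg_subl.
  rewrite centsC; apply/commG1P; apply: contraTeq isT => ntR.
  have [_ pdv _] := pgroup_pdiv (pgroupS (subset_trans sRZ sZT) pT) ntR.
  have [x Rx ox] := Cauchy p_pr pdv; have Zx := subsetP sRZ x Rx.
  have: x != 1 by rewrite -order_gt1 ox prime_gt1.
  rewrite -in_set1 -[[set 1]]/(1 : {set gT}) -tiZ !(inE, Rx, Zx) /= centsC in cDQ *.
  rewrite (subsetP cDQ) // inD ?(subsetP sZH) //.
  by rewrite expnS expgM -ox expg_order expg1n.
have cHQ: Q \subset 'C(H).
  apply: comm1 => //; rewrite (subset_trans _ (_ : D \subset _)) 1?centsC //.
  rewrite gen_subG; apply/subsetP=> _ /imset2P[x a Hx Qa ->].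
  have Hxa: x ^ a \in H by rewrite memJ_norm // (subsetP nHQ).
  have Hu: [~ x, a] \in H by rewrite groupM ?groupV.
  apply: inD => //; apply: (mulgI (x ^+ (p ^ 2))).
  rewrite -(critical_expMg p_pr pT cH) // -conjg_mulR mulg1 -conjXg.
  have Zxp: x ^+ p \in 'Z(H).
    rewrite (subsetP sPhiZ) // (Phi_joing pH) (subsetP (joing_subr _ _)) //.
    by rewrite -[p]expn1 Mho_p_elt ?(mem_p_elt pH).
  by rewrite expnS expgM conjXg (conjgE (x ^+ p)) -(centsP cZQ _ Qa _ Zxp) mulKg.
have cRQ: [~: T, Q] \subset 'Z(H).
  rewrite -cTH subsetI commg_subl nTQ /=; apply/commG1P.
  rewrite [[~: T, Q]]commGC; apply: three_subgroup.
    by apply/commG1P; rewrite centsC (subset_trans cHQ) ?centS //; apply: subset_trans sZH.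
  by rewrite [[~: H, Q]]commGC (commG1P cHQ) comm1G.
by apply: comm1 => //; rewrite (subset_trans cRQ) // centsC.
Qed.

End SmallExponent.

Lemma pgroup_elts pi (gT : finGroupType) (G : {group gT}) :
  {in G, forall x, pi.-elt x} -> pi.-group G.
Proof.
move=> piG; apply/pgroupP=> q q_pr /(Cauchy q_pr)[x Gx ox].
by have := piG x Gx; rewrite /p_elt ox pnatE.
Qed.

Lemma p_elt_expg_p2 p (gT : finGroupType) (x : gT) :
  prime p -> x ^+ (p ^ 2) = 1 -> p.-elt x.
Proof.
move=> p_pr x1; apply: (@pnat_dvd _ (p ^ 2)); first by rewrite order_dvdn x1.
by rewrite pnatX pnat_id.
Qed.

Lemma p_elt_conj_Sylow p (gT : finGroupType) (G P : {group gT}) x :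
  p.-Sylow(G) P -> x \in G -> p.-elt x -> exists2 g, g \in G & x ^ g \in P.
Proof.
move=> sylP Gx px; have sxG : <[x]> \subset G by rewrite cycle_subG.
have [g Gg sxP] := Sylow_subJ sylP sxG px.
by exists g^-1; rewrite ?groupV // -mem_conjg -cycle_subG.
Qed.

(** * The p-residual *)

Section PResidual.

Variables (p : nat) (gT : finGroupType).
Implicit Types (G S : {group gT}).

(** On a group this is the smallest normal subgroup with p-group quotient.  Having
generators of order prime to p reduces centralisation to coprime actions. *)
Definition p_residual (A : {set gT}) := <<[set x in A | p^'.-elt x]>>.

Canonical p_residual_group A := Eval hnf in [group of p_residual A].

Lemma p_residual_sub G : p_residual G \subset G.
Proof. by rewrite gen_subG; apply/subsetP=> x /[!inE] /andP[]. Qed.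

Lemma mem_p_residual G x : x \in G -> p^'.-elt x -> x \in p_residual G.
Proof. by move=> Gx p'x; rewrite mem_gen // inE Gx. Qed.

Lemma p_residual_norm G : 'N(G) \subset 'N(p_residual G).
Proof.
apply: subset_trans (norm_gen _); apply/subsetP=> a nGa; rewrite inE.
apply/subsetP=> _ /imsetP[x /[!inE] /andP[Gx p'x] ->].
by rewrite p_eltJ memJ_norm ?Gx.
Qed.

Lemma p_residual_normal G : p_residual G <| G.
Proof.
by rewrite /normal p_residual_sub (subset_trans (normG G) (p_residual_norm G)).
Qed.

Lemma p_residual_quotient G : p.-group (G / p_residual G).
Proof.
have nRG := normal_norm (p_residual_normal G).
apply: pgroup_elts => _ /morphimP[x Nx Gx ->] /=.
have -> : coset (p_residual G) x = coset (p_residual G) x.`_p.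
  rewrite -{1}(consttC p x) morphM ?groupX //= (coset_id (x := x.`_p^')) ?mulg1 //.
  by rewrite mem_p_residual ?groupX ?p_elt_constt.
by rewrite morph_p_elt ?groupX ?p_elt_constt.
Qed.

(** A Sylow subgroup covers the quotient, which is a p-group. *)
Lemma p_residual_mulSylow G S : p.-Sylow(G) S -> p_residual G * S = G.
Proof.
move=> sylS; have nRG := normal_norm (p_residual_normal G).
have sSG := pHall_sub sylS.
apply/eqP; rewrite eqEsubset mul_subG ?p_residual_sub //=.
rewrite -quotientSK //; have := quotient_pHall (subset_trans sSG nRG) sylS.
by move/pHall_id=> -> //; apply: p_residual_quotient.
Qed.

Lemma p_residual_id G : p_residual (p_residual G) = p_residual G.
Proof.
apply/eqP; rewrite eqEsubset p_residual_sub gen_subG.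
apply/subsetP=> x /[!inE] /andP[Gx p'x].
by rewrite mem_p_residual ?mem_p_residual.
Qed.

End PResidual.

(** * Fusion and transfer when p'-elements centralise the p-subgroups they normalise *)

Section Frobenius.

Variables (p : nat) (gT : finGroupType) (W : {group gT}).
Implicit Types (D P Q : {group gT}).
Hypothesis cNW : forall D, p.-group D -> D \subset W ->
  p_residual p 'N_W(D) \subset 'C(D).

(** This is the fusion argument of Frobenius, by descending induction on the order
of the intersection D = P :&: Q.  Sylow subgroups of 'N_W(D) are conjugate under
the p-residual of 'N_W(D), which centralises D.  Choosing two of them above
'N_P(D) and 'N_Q(D) links P to Q through Sylow subgroups of W whose
consecutive intersections are larger than D. *)
Lemma Sylow_conj_cent P Q : p.-Sylow(W) P -> p.-Sylow(W) Q ->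
  exists2 c, c \in 'C_W(P :&: Q) & Q :=: P :^ c.
Proof.
have [n] := ubnP (#|P| - #|P :&: Q|); elim: n => // n IHn in P Q *.
rewrite ltnS => lePQn sylP sylQ; set D := P :&: Q in lePQn *.
have [sPW pP _] := and3P sylP; have [sQW pQ _] := and3P sylQ.
have oPQ: #|P| = #|Q| by rewrite (card_Hall sylP) (card_Hall sylQ).
have [sPQ|nsPQ] := boolP (P \subset Q).
  have <-: P :=: Q by apply/eqP; rewrite eqEcard sPQ oPQ leqnn.
  by exists 1; rewrite ?group1 ?conjsg1.
have prDP: D \proper P.
  by rewrite properE subsetIl; apply: contra nsPQ => /subset_trans->; rewrite ?subsetIr.
have prDQ: D \proper Q.
  by rewrite properEcard subsetIr -oPQ proper_card.
have prNP := nilpotent_proper_norm (pgroup_nil pP) prDP.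
have prNQ := nilpotent_proper_norm (pgroup_nil pQ) prDQ.
pose N := 'N_W(D)%G; have sNW: N \subset W := subsetIl _ _.
have sNPN: 'N_P(D) \subset N := setSI _ sPW.
have sNQN: 'N_Q(D) \subset N := setSI _ sQW.
have [S1 sylS1 sNPS1] := Sylow_superset sNPN (pgroupS (subsetIl _ _) pP).
have [S2 sylS2 sNQS2] := Sylow_superset sNQN (pgroupS (subsetIl _ _) pQ).
have [sS1N pS1 _] := and3P sylS1; have [sS2N pS2 _] := and3P sylS2.
(* The induction hypothesis, for Sylow subgroups sharing a subgroup above D. *)
have IHX (A B X : {group gT}) : p.-Sylow(W) A -> p.-Sylow(W) B -> D \proper X ->
  X \subset A -> X \subset B -> exists2 c, c \in 'C_W(D) & B :=: A :^ c.
  move=> sylA sylB prDX sXA sXB.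
  have sXAB: X \subset A :&: B by rewrite subsetI sXA.
  have prD := proper_sub_trans prDX sXAB.
  have [|c cABc ->] := IHn A B _ sylA sylB.
    rewrite (card_Hall sylA) -(card_Hall sylP); apply: leq_trans lePQn.
    by rewrite ltn_sub2l ?proper_card // (card_Hall sylP) -(card_Hall sylA)
      (leq_trans (proper_card prD)) ?subset_leq_card ?subsetIl.
  exists c => //; apply: subsetP cABc; rewrite setIS ?centS //.
  exact: proper_sub.
have [P2 sylP2 sS1P2] := Sylow_superset (subset_trans sS1N sNW) pS1.
have [c1 Cc1 defP2] :=
  IHX _ _ _ sylP sylP2 prNP (subsetIl _ _) (subset_trans sNPS1 sS1P2).
have [g Ng defS2] := Sylow_trans sylS1 sylS2.
have := p_residual_mulSylow sylS1.
rewrite -(normC (subset_trans sS1N (normal_norm (p_residual_normal _ _)))).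
move=> defN; move: Ng; rewrite -defN => /mulsgP[s c2 S1s Rc2 def_g].
have Cc2: c2 \in 'C_W(D).
  rewrite inE (subsetP sNW) ?(subsetP (p_residual_sub _ _) _ Rc2) //=.
  have sDP: D \subset P := subsetIl _ _.
  exact: subsetP (cNW (pgroupS sDP pP) (subset_trans sDP sPW)) _ Rc2.
have [W_c2 _] := setIP Cc2.
have sylP3: p.-Sylow(W) (P2 :^ c2) by rewrite pHallJ.
have sNQP3: 'N_Q(D) \subset P2 :^ c2.
  by rewrite (subset_trans sNQS2) // defS2 def_g conjsgM (conjGid S1s) conjSg.
have [c3 Cc3 ->] := IHX _ _ _ sylP3 sylQ prNQ sNQP3 (subsetIl _ _).
by exists (c1 * c2 * c3); rewrite ?groupM // 2!conjsgM -defP2.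
Qed.

(** P and its conjugate by g are also conjugate by an element centralising their
intersection, so g may be taken in 'N_W(P), where only P acts on P. *)
Lemma Sylow_fusion P x g : p.-Sylow(W) P -> x \in P -> g \in W ->
  x ^ g \in P -> exists2 u, u \in P & x ^ g = x ^ u.
Proof.
move=> sylP Px Wg Pxg; have sylPg: p.-Sylow(W) (P :^ g) by rewrite pHallJ.
have [c /setIP[Wc Cc] defP] := Sylow_conj_cent sylPg sylP.
have Ngc: g * c \in 'N_W(P) by rewrite inE groupM //= inE conjsgM -defP.
have [sPW pP _] := and3P sylP.
have sylPN: p.-Sylow('N_W(P)) P.
  by rewrite (pHall_subl _ _ sylP) ?subsetIl // subsetI sPW normG.
move: Ngc; rewrite -(p_residual_mulSylow sylPN) => /mulsgP[k u Rk Pu def_gc].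
have Ck := subsetP (cNW pP sPW) _ Rk.
exists u => //; have ->: x ^ u = x ^ (g * c).
  by rewrite def_gc conjgM [x ^ k]conjgE -(centP Ck) // mulKg.
by rewrite conjgM [(x ^ g) ^ c]conjgE -(centP Cc) ?mulKg // inE memJ_conjg Px.
Qed.

(** By [Sylow_fusion] the transfer of W into P / P^`(1) raises the image of an
element of P to the power given by the index of P.  It is trivial because W is
generated by p'-elements, and that index is prime to p; hence P = P^`(1), and P is
trivial. *)
Lemma Frobenius_p_residual : p_residual p W = W -> p^'.-group W.
Proof.
move=> defW; have [P sylP] := Sylow_exists p W.
have [sPW pP p'WP] := and3P sylP.
pose alpha := restrm_morphism (der_norm 1 P) (coset_morphism P^`(1)).
have abelA: abelian (alpha @* P) by rewrite morphim_restrm setIid; apply: der_abelian.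
pose f := transfer_morphism W abelA.
have pA: p.-group (alpha @* P) by rewrite morphim_pgroup.
(* The transfer f is trivial: the order of f z is prime to p for a generator z,
   and a power of p as f takes its values in a p-group. *)
have f1 y: y \in W -> f y = 1.
  move=> Wy; suff: y \in 'ker f by apply: mker.
  rewrite -defW in Wy; apply: subsetP Wy; rewrite gen_subG.
  apply/subsetP=> z /[!inE] /andP[Wz p'z]; rewrite Wz /=.
  have Afz: FiniteModule.fmval (f z) \in alpha @* P by apply: FiniteModule.fmodP.
  apply/eqP/val_inj/eqP; rewrite -[_ == _]/(FiniteModule.fmval (f z) == 1).
  rewrite -order_eq1 -[#[_]]gcdnn.
  apply: (pnat_coprime (pi := p)); first exact: mem_p_elt pA Afz.
  apply: pnat_dvd p'z; rewrite order_dvdn -FiniteModule.fmvalZ.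
  by rewrite -[(_ *+ _)%R]/(f z ^+ _) -morphX // expg_order morph1.
have aM g h: g \in P -> h \in P -> alpha (g * h) = alpha g * alpha h.
  exact: morphM.
(* In the expansion over the cycles of g, each term is the image of a
   P-conjugate of a power of g, and the exponents add up to the index. *)
have fP g: g \in P -> alpha g ^+ #|W : P| = 1.
  move=> Pg; have Wg := subsetP sPW g Pg.
  have trX := transversalP (rcosets_cycle_partition sPW Wg).
  set X := transversal _ _ in trX.
  have := f1 g Wg; rewrite /= (transfer_cycle_expansion sPW abelA Wg trX).
  move/(congr1 val)/(etrans _); apply; rewrite /= FiniteModule.fmval_sum.
  rewrite -(sum_index_rcosets_cycle sPW Wg trX).
  rewrite (big_morph _ (expgD (alpha g)) (expg0 _)); apply: eq_bigr => x Xx /=.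
  have Wx: x \in W by apply: (subsetP (transversal_sub trX)).
  set n := #|_ : _|; have Pgn: g ^+ n \in P by rewrite groupX.
  have Pxgn: (g ^+ n) ^ x^-1 \in P.
    by rewrite conjgE invgK mulgA -mem_rcoset mulg_exp_card_rcosets.
  rewrite FiniteModule.fmodK ?mem_morphim // -[RHS]/(alpha _).
  have [u Pu ->] := Sylow_fusion sylP Pgn (groupVr Wx) Pxgn.
  rewrite morphJ // -morphX // conjgE.
  by rewrite -(centsP abelA (alpha u)) ?mulKg ?mem_morphim.
have defP: P^`(1) = P.
  apply/eqP; rewrite eqEsubset der_sub; apply/subsetP=> g Pg.
  have: alpha g = 1.
    apply/eqP; rewrite -order_eq1 -[#[_]]gcdnn.
    apply: (pnat_coprime (pi := p)).
      by apply: mem_p_elt pA _; rewrite mem_morphim.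
    by apply: pnat_dvd p'WP; rewrite order_dvdn fP.
  by move/(coset_idr (subsetP (der_norm 1 P) g Pg)).
have P1: P :=: 1.
  apply/eqP/idPn=> ntP; have := sol_der1_proper (pgroup_sol pP) (subxx P) ntP.
  by rewrite defP properxx.
by move: p'WP; rewrite P1 indexg1.
Qed.

End Frobenius.

(** * Groups whose p-elements of small order are central *)

Section Ito.

Variables (p : nat) (gT : finGroupType).
Implicit Types (G W T : {group gT}).
Hypothesis p_pr : prime p.

(** Elements of order prime to p act on T as they act on the subgroup provided by
[char_subgroup_exponent_p2]. *)
Lemma p_residual_centS G T : p.-group T -> G \subset 'N(T) ->
  {in T, forall x, x ^+ (p ^ 2) = 1 -> p_residual p G \subset 'C[x]} ->
  p_residual p G \subset 'C(T).
Proof.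
move=> pT nTG cT; have [D [chD expD cDT]] := char_subgroup_exponent_p2 p_pr pT.
rewrite gen_subG; apply/subsetP=> y /[!inE] /andP[Gy p'y].
rewrite -cycle_subG cDT ?cycle_subG ?(subsetP nTG) //.
apply/centP=> x Dx; have Tx := subsetP (char_sub chD) x Dx.
have /cent1P := subsetP (cT x Tx (expD x Dx)) y (mem_p_residual Gy p'y).
by move/commute_sym.
Qed.

(** The p-residual R of W centralises the elements of order dividing p ^ 2, hence
every p-subgroup of R which it normalises, and [Frobenius_p_residual] makes R a
normal p'-subgroup of W. *)
Lemma Ito_pgroup W : 'O_p^'(W) = 1 ->
  {in W, forall x, x ^+ (p ^ 2) = 1 -> p_residual p W \subset 'C[x]} ->
  p.-group W.
Proof.
move=> Op'W cW; pose R := p_residual_group p W.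
have nsRW: R <| W := p_residual_normal p W.
have p'R: p^'.-group R.
  apply: (Frobenius_p_residual (p := p)) => [D pD sDR|]; last exact: p_residual_id.
  apply: p_residual_centS => //; first exact: subsetIr.
  move=> x Dx x1; have Wx := subsetP (subset_trans sDR (normal_sub nsRW)) x Dx.
  apply: subset_trans (cW x Wx x1); apply: subset_trans (p_residual_sub _ _) _.
  exact: subsetIl.
have R1: R :=: 1.
  by apply/trivgP; rewrite -Op'W pcore_max.
have := p_residual_quotient p W; rewrite -[p_residual p W]/(gval R) R1.
by rewrite -(isog_pgroup _ (quotient1_isog W)).
Qed.

End Ito.

(** * Chief factors and minimal normal subgroups *)

Section Chief.

Variables (gT : finGroupType) (G : {group gT}).
Implicit Types (M N U V : {group gT}).

Lemma chief_factor_context V U : chief_factor G V U ->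
  [/\ V <| G, U <| G & V \proper U].
Proof.
case/andP=> maxV nsUG; have /andP[prVU nVG] := maxgroupp maxV.
by split; rewrite // /normal nVG (subset_trans (proper_sub prVU)) ?normal_sub.
Qed.

Lemma chief_factor_sub V U M : chief_factor G V U -> G \subset 'N(M) ->
  V \subset M -> M \subset U -> ~~ (M \subset V) -> M :=: U.
Proof.
case/andP=> /maxgroupP[_ maxV] _ nMG sVM sMU nsMV.
apply/eqP; rewrite eqEproper sMU; apply: contra nsMV => prMU.
by rewrite (maxV M) ?prMU.
Qed.

Lemma chief_pgroup_abelem (p : nat) V U : chief_factor G V U -> p.-group (U / V) ->
  p.-abelem (U / V) /\ U / V != 1.
Proof.
move=> chVU pUV; have minUV := chief_factor_minnormal chVU.
have /andP[-> _] := mingroupp minUV; split=> //.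
have [_ _] := minnormal_solvable minUV (subxx _) (pgroup_sol pUV).
by rewrite (is_abelem_pgroup pUV).
Qed.

Lemma minnormal_normal N : minnormal N G -> N \subset G -> N <| G.
Proof. by case/mingroupP=> /andP[_ nNG] _ sNG; rewrite /normal sNG. Qed.

Lemma minnormal_sub N M : minnormal N G -> G \subset 'N(M) ->
  N :&: M != 1 -> N \subset M.
Proof.
case/mingroupP=> /andP[_ nNG] minN nMG ntNM.
by apply/setIidPl; apply: minN; rewrite ?subsetIl // ntNM normsI.
Qed.

Lemma minnormal_TI N M : minnormal N G -> G \subset 'N(M) ->
  ~~ (N \subset M) -> N :&: M = 1.
Proof. by move=> minN nMG; apply: contraNeq; apply: minnormal_sub. Qed.

(** N is isomorphic to U / V as soon as some element of N appears at the factor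
U / V; this transports to N what is known of that factor. *)
Lemma minnormal_chief N V U x : minnormal N G -> N \subset G ->
  chief_factor G V U -> x \in N -> x \in U -> x \notin V ->
  [/\ N \subset U, N :&: V = 1, V * N = U & N \isog U / V].
Proof.
move=> minN sNG chVU Nx Ux V'x.
have [nsVG nsUG prVU] := chief_factor_context chVU.
have [_ nVG] := andP nsVG.
have ntx: x != 1 by apply: contraNneq V'x => ->.
have sNU: N \subset U.
  apply: minnormal_sub (normal_norm nsUG) _ => //; apply/trivgPn.
  by exists x; rewrite // inE Nx.
have tiNV: N :&: V = 1.
  by apply: (minnormal_TI minN nVG); apply/subsetPn; exists x.
have nVN := subset_trans sNG nVG.
have /andP[_ nNG] := mingroupp minN.
have defU: V * N = U.
  rewrite -norm_joinEr //; apply: (chief_factor_sub chVU).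
  - exact: normsY.
  - exact: joing_subl.
  - by rewrite join_subG proper_sub.
  by apply/subsetPn; exists x; rewrite // (subsetP (joing_subr _ _)).
split=> //; rewrite -defU quotientMidl.
by apply: quotient_isog; rewrite // setIC.
Qed.

(** The socle of G as a group, as opposed to the socle of a representation. *)
Definition gsocle : {set gT} :=
  <<\bigcup_(N : {group gT} | minnormal N G && (N \subset G)) N>>.

Canonical gsocle_group := Eval hnf in [group of gsocle].

Lemma minnormal_gsocle N : minnormal N G -> N \subset G -> N \subset gsocle.
Proof.
move=> minN sNG; apply: sub_gen.
by apply: (bigcup_sup (N : {group gT})); rewrite minN.
Qed.

Lemma gsocle_subP (X : {group gT}) :
  (forall N, minnormal N G -> N \subset G -> N \subset X) -> gsocle \subset X.
Proof.
move=> sX; rewrite gen_subG; apply/bigcupsP=> N /andP[minN sNG].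
exact: sX.
Qed.

Lemma gsocle_nsub (X : {group gT}) : ~~ (gsocle \subset X) ->
  exists N, [/\ minnormal N G, N \subset G & ~~ (N \subset X)].
Proof.
move=> nsX; suff /existsP[N /and3P[? ? ?]] :
  [exists N : {group gT}, [&& minnormal N G, N \subset G & ~~ (N \subset X)]].
  by exists N.
apply: contraR nsX; rewrite negb_exists => /forallP nX.
apply: gsocle_subP => N minN sNG.
by have := nX N; rewrite minN sNG /= negbK.
Qed.

Lemma gsocle_normal : gsocle <| G.
Proof.
rewrite /normal gsocle_subP //=; apply: subset_trans (norm_gen _).
apply/subsetP=> g Gg; rewrite inE; apply/subsetP=> _ /imsetP[x /bigcupP[N minN Nx] ->].
apply/bigcupP; exists N => //; case/andP: minN => minN _.
by have /andP[_ nNG] := mingroupp minN; rewrite memJ_norm // (subsetP nNG).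
Qed.

End Chief.

(** * Chief factors of order the square of p *)

Section RankTwo.

Variables (p : nat) (gT : finGroupType) (G P : {group gT}).
Implicit Types (A N : {group gT}).
Hypotheses (p_pr : prime p) (pP : p.-group P) (sPG : P \subset G).

(** Otherwise A has order p.  The intersection Z of N with the centre of the
p-group N P is another subgroup of order p.  If P moves A, then the P-conjugates of
A already contain all elements of N outside Z; as G = N_G(A) P and Z is not a
P-conjugate of A, it follows that Z is normal in G. *)
Lemma minnormal_p2_subgroup N A : minnormal N G -> #|N| = (p ^ 2)%N ->
  A \subset N -> A :!=: 1 -> 'N_G(A) * P = G -> A :=: N.
Proof.
move=> minN oN sAN ntA defG; apply/eqP; apply: contraT => neAN.
have [/andP[ntN nNG] minNN] := mingroupP minN.
have nA : ~~ (G \subset 'N(A)).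
  by apply: contra neAN => nAG; apply/eqP/minNN; rewrite // ntA.
have nAP : ~~ (P \subset 'N(A)).
  by apply: contra nA => nAP; rewrite -defG mul_subG ?subsetIr.
have pN : p.-group N by rewrite /pgroup oN pnatX pnat_id.
have nNP := subset_trans sPG nNG.
have dvp2 (D : {group gT}) : D \subset N -> D :!=: 1 -> D :!=: N -> #|D| = p.
  move=> sDN ntD neDN; have := cardSg sDN; rewrite oN.
  case/(dvdn_pfactor _ _ p_pr) => m + oD; case: m oD => [|[|[|k]]] // oD _.
    by move/eqP: oD; rewrite expn0 -trivg_card1 (negPf ntD).
  by case/eqP: neDN; apply/eqP; rewrite eqEcard sDN oN oD leqnn.
have oA := dvp2 A sAN ntA neAN.
pose Q := (N <*> P)%G.
have pQ : p.-group Q by rewrite /= norm_joinEr // pgroupM pN.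
have [sNQ sPQ] : N \subset Q /\ P \subset Q by rewrite joing_subl joing_subr.
have nsNQ : N <| Q by rewrite /normal sNQ join_subG normG.
pose Z := (N :&: 'Z(Q))%G.
have ntZ : Z :!=: 1 by apply: meet_center_nil (pgroup_nil pQ) nsNQ ntN.
have sZN : Z \subset N := subsetIl _ _.
have cZP : P \subset 'C(Z).
  by rewrite (subset_trans sPQ) // centsC subIset // subIset ?subxx ?orbT.
have neZN : Z :!=: N.
  apply: contra nAP => /eqP defZ; rewrite cents_norm //.
  by rewrite (subset_trans cZP) // centS // defZ.
have oZ := dvp2 Z sZN ntZ neZN.
have neAZ : A :!=: Z.
  by apply: contra nAP => /eqP ->; rewrite cents_norm.
have prA : prime #|A| by rewrite oA.
have tiAZ : A :&: Z = 1.
  apply: prime_TIg => //; apply: contra neAZ => sAZ.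
  by rewrite eqEcard sAZ oA oZ leqnn.
have cAZ : A \subset 'C(Z).
  rewrite (subset_trans (subset_trans sAN sNQ)) // centsC subIset //.
  by rewrite subIset ?subxx ?orbT.
have defN : A * Z = N.
  by apply/eqP; rewrite eqEcard mul_subG // TI_cardMg // oN oA oZ leqnn.
(* N / Z has order p, so the p-group Q centralises it. *)
have cNQ : [~: N, Q] \subset Z.
  have nZQ : Q \subset 'N(Z).
    by rewrite cents_norm // centsC subIset // subIset ?subxx ?orbT.
  have nZN := subset_trans sNQ nZQ.
  rewrite -quotient_cents2 //.
  have oNZ : #|N / Z| = p.
    apply/eqP; rewrite -(eqn_pmul2l (prime_gt0 p_pr)) -{1}oZ card_quotient //.
    by rewrite Lagrange // oN.
  have nsNZ : N / Z <| Q / Z by apply: quotient_normal.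
  have ntNZ : N / Z != 1 by rewrite -cardG_gt1 oNZ prime_gt1.
  have := meet_center_nil (quotient_nil Z (pgroup_nil pQ)) nsNZ ntNZ.
  have [|sNZ _|tiZ /eqP[]] := @prime_subgroupVti _ (N / Z)%G 'Z(Q / Z)%G.
  - by rewrite oNZ.
  - by rewrite (subset_trans sNZ) // subsetIr.
  by rewrite setIC tiZ.
(* As z is central in Q, the conjugate of a by u ^+ j is a * [~ a, u] ^+ j, and
   [~ a, u] generates Z. *)
have [u Pu nAu] := subsetPn nAP.
have coverN b : b \in N -> b \notin Z -> exists2 w, w \in P & b \in A :^ w.
  rewrite -{1}defN => /mulsgP[a z Aa Zz ->] nZaz.
  have nta : a != 1 by apply: contraNneq nZaz => ->; rewrite mul1g.
  have Na := subsetP sAN a Aa; have Qu := subsetP sPQ u Pu.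
  have Zau : [~ a, u] \in Z by rewrite (subsetP cNQ) ?mem_commg.
  have defA : <[a]> = A by rewrite [RHS](nt_gen_prime prA (x := a)) // !inE nta.
  have ntau : [~ a, u] != 1.
    apply: contra nAu => /commgP cau; rewrite -defA.
    by rewrite (subsetP (cent_sub _)) // cent_cycle; apply/cent1P.
  have defZ : <[[~ a, u]]> = Z.
    by rewrite [RHS](@nt_gen_prime _ Z [~ a, u]) ?oZ // in_setD1 ntau.
  have /cycleP[j def_z] : z \in <[[~ a, u]]> by rewrite defZ.
  exists (u ^+ j); rewrite ?groupX // -defA -cycleJ conjg_mulR commgX.
    by rewrite -def_z cycle_id.
  by apply: commute_sym; apply: (centsP _ _ Zau _ Pu); rewrite centsC.
have nZ : ~~ (G \subset 'N(Z)).
  apply: contra neZN => nZG; apply/eqP; by apply: minNN => //; rewrite ntZ nZG.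
case/negP: nZ; apply/subsetP=> g Gg; rewrite inE; apply/subsetP=> _ /imsetP[z Zz ->].
apply: contraT => nZzg.
have Nzg : z ^ g \in N by rewrite memJ_norm ?(subsetP sZN) // (subsetP nNG).
have [w Pw] := coverN _ Nzg nZzg; rewrite mem_conjg -conjgM => Azg.
have := groupM Gg (groupVr (subsetP sPG w Pw)).
rewrite -groupV -defG => /mulsgP[n v /setIP[_ Nn] Pv def_gw].
have Az : z \in A.
  have def : g * w^-1 = v^-1 * n^-1 by rewrite -invMg -def_gw invgK.
  move: Azg; rewrite def conjgM memJ_norm ?groupV // conjgE invgK.
  by rewrite -(centsP cZP _ (groupVr Pv) _ Zz) mulKVg.
have : z \in A :&: Z by rewrite inE Az.
by rewrite tiAZ => /set1P z1; rewrite z1 conj1g group1 in nZzg.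
Qed.

End RankTwo.

Lemma chief_p2_subgroup (p : nat) (gT : finGroupType) (G P A U V : {group gT}) :
    prime p -> p.-group P -> P \subset G ->
    chief_factor G V U -> #|U / V| = (p ^ 2)%N ->
    V \subset A -> A \subset U -> ~~ (A \subset V) -> 'N_G(A) * P = G ->
  A :=: U.
Proof.
move=> p_pr pP sPG chVU oUV sVA sAU nsAV defG.
have [nsVG nsUG prVU] := chief_factor_context chVU.
have [[sVG nVG] sVU] := (andP nsVG, proper_sub prVU).
have nVA := subset_trans (subset_trans sAU (normal_sub nsUG)) nVG.
have nVU := subset_trans (normal_sub nsUG) nVG.
have nsVA : V <| A by rewrite /normal sVA.
have defAV : A / V = U / V.
  apply: (minnormal_p2_subgroup (G := (G / V)%G) (P := (P / V)%G) p_pr _ _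
    (N := (U / V)%G) (A := (A / V)%G)).
  - exact: quotient_pgroup.
  - exact: quotientS.
  - exact: chief_factor_minnormal.
  - by [].
  - exact: quotientS.
  - by rewrite -subG1 quotient_sub1.
  by rewrite /= -quotient_subnormG // -quotientMl ?defG // subIset ?nVG.
by apply: (quotient_inj nsVA _ defAV); rewrite /normal sVU.
Qed.

(** * The kernel of the action on chief factors of order p *)

Section ScalarKernel.

Variables (p : nat) (gT : finGroupType).
Implicit Types (E G : {group gT}).

(** On a group this is the smallest normal subgroup whose quotient is abelian of
exponent dividing p - 1, that is, whose quotient acts by scalars on irreducible
modules over the field with p elements. *)
Definition scalar_kernel (A : {set gT}) :=
  <<[set x ^+ p.-1 | x in A] :|: commg_set A A>>.

Canonical scalar_kernel_group A := Eval hnf in [group of scalar_kernel A].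

Lemma scalar_kernel_sub G : scalar_kernel G \subset G.
Proof.
rewrite gen_subG subUset; apply/andP; split.
  by apply/subsetP=> _ /imsetP[x Gx ->]; rewrite groupX.
by apply: subset_trans (subset_gen _) (der_sub 1 G).
Qed.

Lemma scalar_kernel_normal G : scalar_kernel G <| G.
Proof.
apply: sub_der1_normal; last exact: scalar_kernel_sub.
by rewrite genS ?subsetUr.
Qed.

(** Since p - 1 is prime to p, x generates the same subgroup as x ^+ p.-1. *)
Lemma mem_scalar_kernel G x : prime p -> p.-elt x -> x \in G ->
  x \in scalar_kernel G.
Proof.
move=> p_pr px Gx; have: generator <[x]> (x ^+ p.-1).
  case/p_natP: px => k ox.
  by rewrite generator_coprime ox coprimeXl // coprimenP ?prime_gt0.
move/eqP=> defx; have: x \in <[x ^+ p.-1]> by rewrite -defx cycle_id.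
apply: subsetP; rewrite cycle_subG mem_gen // inE.
by apply/orP; left; apply: imset_f.
Qed.

(** The automorphism group of a group of order p is cyclic of order p - 1. *)
Lemma scalar_kernel_cent_prime G E : prime p -> #|E| = p -> G \subset 'N(E) ->
  scalar_kernel G \subset 'C(E).
Proof.
move=> p_pr oE nEG.
have cycA : cyclic (Aut E) by rewrite Aut_prime_cyclic ?oE.
have oA : #|Aut E| = p.-1.
  by rewrite card_Aut_cyclic ?prime_cyclic ?oE // totient_prime.
have Ax x : conj_aut E x \in Aut E by apply: Aut_aut.
rewrite gen_subG /= -(ker_conj_aut E); apply/subsetP=> z /setUP[/imsetP|/imset2P].
  case=> x /(subsetP nEG) Nx ->; apply/kerP; rewrite ?groupX // morphX //.
  by apply/eqP; rewrite -order_dvdn -oA order_dvdG ?Ax.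
case=> x y /(subsetP nEG) Nx /(subsetP nEG) Ny ->; apply/kerP; rewrite ?groupR //.
rewrite morphR //; apply/eqP/commgP.
by apply: (centsP (cyclic_abelian cycA)); apply: Ax.
Qed.

End ScalarKernel.

Section ScalarKernelChief.

Variables (p : nat) (gT : finGroupType).
Implicit Types (G U V : {group gT}).

Lemma scalar_kernel_quotient G V : G \subset 'N(V) ->
  scalar_kernel p G / V = scalar_kernel p (G / V).
Proof.
move=> nVG; have sBG := scalar_kernel_sub p G.
apply/eqP; rewrite eqEsubset (sub_quotient_pre _ (subset_trans sBG nVG)) !gen_subG.
apply/andP; split; apply/subsetP=> z /setUP[/imsetP|/imset2P].
- case=> x Gx ->; have Nx := subsetP nVG x Gx.
  apply/morphpreP; rewrite /= morphX // groupX // mem_gen // inE.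
  by apply/orP; left; apply: (imset_f (fun y => y ^+ p.-1)); rewrite mem_quotient.
- case=> x y Gx Gy ->; have [Nx Ny] := (subsetP nVG x Gx, subsetP nVG y Gy).
  apply/morphpreP; rewrite /= morphR // groupR // mem_gen // inE.
  by apply/orP; right; apply: imset2_f; rewrite mem_quotient.
- case=> _ /morphimP[x Nx Gx ->] ->; rewrite -morphX // mem_quotient // mem_gen //.
  by rewrite inE (imset_f (fun y => y ^+ p.-1)).
case=> _ _ /morphimP[x Nx Gx ->] /morphimP[y Ny Gy ->] ->.
rewrite -morphR // mem_quotient // mem_gen // inE.
by apply/orP; right; apply: imset2_f.
Qed.

Lemma scalar_kernel_comm_chief G V U : prime p -> chief_factor G V U ->
  #|U / V| = p -> [~: U, scalar_kernel p G] \subset V.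
Proof.
move=> p_pr chVU oUV; have [nsVG nsUG prVU] := chief_factor_context chVU.
have [sVG nVG] := andP nsVG; have sBG := scalar_kernel_sub p G.
rewrite -(quotient_cents2 (subset_trans (normal_sub nsUG) nVG) (subset_trans sBG nVG)).
rewrite centsC.
have nUV : G / V \subset 'N(U / V) by rewrite quotient_norms ?normal_norm.
by rewrite (scalar_kernel_quotient nVG) scalar_kernel_cent_prime.
Qed.

End ScalarKernelChief.

Section IrrScalar.

Import GRing.Theory.
Local Open Scope ring_scope.

(** The product of the X - a over F is X^#|F| - X, which kills each rG x, and by
Schur's lemma each factor rG x - a is zero or invertible; so rG x is a scalar, and
every line is stable. *)
Lemma mx_irr_scalar_degree1 (F : finFieldType) (gT : finGroupType)
    (G : {group gT}) n (rG : mx_representation F G n.+1) :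
  mx_irreducible rG ->
  {in G &, forall x y, rG x *m rG y = rG y *m rG x} ->
  {in G, forall x, rG x ^+ #|F| = rG x} -> n = 0%N.
Proof.
move=> irrG cGG expG.
have scalG x : x \in G -> exists a, rG x = a%:M.
  move=> Gx; suff /existsP[a /eqP->]: [exists a, rG x == a%:M] by exists a.
  apply: contraT; rewrite negb_exists => /forallP neq.
  have : \prod_(a : F) (rG x - a%:M) = 0.
    have := congr1 (horner_mx (rG x)) (finField_genPoly F).
    rewrite rmorphB rmorphXn /= horner_mx_X expG // subrr rmorph_prod => /esym.
    by under eq_bigr do rewrite rmorphB /= horner_mx_X horner_mx_C.
  suff : \prod_(a : F) (rG x - a%:M) \in unitmx.
    by move=> U E; move: U; rewrite E unitmxE det0 unitr0.
  elim/big_ind: _ => [|A B uA uB|a _]; first exact: unitmx1.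
    by rewrite -[A * B]/(A *m B) unitmx_mul uA.
  apply: (mx_Schur irrG); last by rewrite subr_eq0.
  by apply/centgmxP=> y Gy; rewrite mulmxBl mulmxBr cGG // scalar_mxC.
have [_ irr] := (mx_irrP rG).1 irrG.
pose U := <<delta_mx 0 0 : 'rV[F]_n.+1>>%MS.
have fullU : row_full U.
  apply: irr; last by rewrite -mxrank_eq0 genmxE mxrank_delta.
  apply/mxmoduleP=> x /scalG[a ->]; rewrite mul_mx_scalar.
  exact: scalemx_sub.
by move: fullU; rewrite /row_full genmxE mxrank_delta => /eqP[].
Qed.

End IrrScalar.

Section Supersoluble.

Variables (p : nat) (gT : finGroupType) (G P : {group gT}).
Implicit Types (U V : {group gT}).
Hypotheses (p_pr : prime p) (sylP : p.-Sylow(G) P).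
Hypotheses (nsPG : P <| G) (sBP : scalar_kernel p G \subset P).

Let sPG : P \subset G := pHall_sub sylP.
Let pP : p.-group P := pHall_pgroup sylP.

(** The Sylow subgroup U :&: P of U is not inside V since p divides the index, and
V (U :&: P) is normal in G. *)
Lemma chief_factor_pgroup V U : chief_factor G V U -> p %| #|U / V| ->
  p.-group (U / V) /\ U / V \subset P / V.
Proof.
move=> chVU pUV; have [nsVG nsUG prVU] := chief_factor_context chVU.
have [[sVG nVG] sVU] := (andP nsVG, proper_sub prVU).
have [sUG nUG] := andP nsUG.
have nVU := subset_trans sUG nVG.
have nVUP : U :&: P \subset 'N(V) by rewrite subIset // nVU.
have defU : (V <*> (U :&: P))%G :=: U.
  apply: (chief_factor_sub chVU); rewrite ?joing_subl //.
  - by rewrite normsY // normsI // normal_norm.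
  - by rewrite join_subG sVU subsetIl.
  rewrite join_subG subxx /=; apply: contraL pUV => sUPV.
  have /and3P[_ _ p'U] := Sylow_setI_normal nsUG sylP.
  rewrite -p'natE // card_quotient //.
  by apply: pnat_dvd p'U; apply: indexgS.
by rewrite -defU /= quotientYidl // quotientS ?subsetIr // quotient_pgroup //
  (pgroupS (subsetIr _ _)).
Qed.

(** P centralises the factor U / V, because it meets the centre of P / V; so G acts
on it as an abelian group of exponent dividing p - 1. *)
Lemma p_supersoluble_scalar_kernel : p_supersoluble p G.
Proof.
move=> V U chVU /(chief_factor_pgroup chVU)[pUV sUP].
have [nsVG nsUG prVU] := chief_factor_context chVU.
have [[sVG nVG] sVU] := (andP nsVG, proper_sub prVU).
have [abE ntE] := chief_pgroup_abelem chVU pUV.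
have minE := chief_factor_minnormal chVU; have /andP[_ nEG] := mingroupp minE.
have cPE : P / V \subset 'C(U / V).
  have nsE : U / V <| P / V.
    by rewrite /normal sUP (subset_trans _ nEG) ?quotientS.
  have ntEZ := meet_center_nil (quotient_nil V (pgroup_nil pP)) nsE ntE.
  have nZG : G / V \subset 'N('Z(P / V)).
    apply: char_norm_trans (center_char _) _.
    by rewrite quotient_norms // normal_norm.
  have := minnormal_sub minE nZG ntEZ.
  by rewrite subsetI centsC => /andP[].
have sBE : scalar_kernel p (G / V) \subset 'C(U / V).
  by rewrite -scalar_kernel_quotient // (subset_trans _ cPE) ?quotientS.
pose rG := abelem_repr abE ntE nEG.
have irrG : mx_irreducible rG by apply/abelem_mx_irrP.
have rB1 y : y \in G / V -> y \in scalar_kernel p (G / V) -> rG y = 1%:M%R.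
  move=> Gy By; have: y \in rker rG by rewrite rker_abelem inE Gy (subsetP sBE).
  by case/rkerP.
have dim1 : abelem_dim' (U / V) = 0.
  apply: mx_irr_scalar_degree1 irrG _ _ => [x y Gx Gy | x Gx].
    rewrite -!repr_mxM // (commgC x y) (repr_mxM rG (groupM Gy Gx) (groupR Gx Gy)).
    rewrite (rB1 _ (groupR Gx Gy)) ?mulmx1 // mem_gen // inE.
    by apply/orP; right; apply: imset2_f.
  transitivity (rG x ^+ p.-1.+1)%R.
    by rewrite card_Fp // prednK // prime_gt0.
  rewrite GRing.exprS.
  suff -> : (rG x ^+ p.-1 = 1)%R by rewrite GRing.mulr1.
  rewrite -repr_mxX // (rB1 _ (groupX _ Gx)) // mem_gen // inE.
  by apply/orP; left; apply/imsetP; exists x.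
by rewrite (abelem_cyclic abE) -(dim_abelemE abE ntE) dim1.
Qed.

End Supersoluble.

(** * Equivariant embeddings and similar representations *)

Section Equivariant.

Variables (gT : finGroupType) (H : {group gT}).
Implicit Types (V : {group gT}) (f g : gT -> gT).

(** A plain function rather than a morphism, since the maps of interest are
restrictions of [remgr] to various subgroups. *)
Definition equivariant_embedding (V1 V2 : {set gT}) f :=
  [/\ {in V1, forall x, f x \in V2},
      {in V1 &, {morph f : x y / x * y}},
      {in V1 & H, forall x h, f (x ^ h) = f x ^ h}
    & {in V1, forall x, f x = 1 -> x = 1}].

Lemma equivariant_id V : equivariant_embedding V V id.
Proof. by split. Qed.

Lemma equivariant_comp V1 V2 V3 f g : H \subset 'N(V1) ->
  equivariant_embedding V1 V2 f -> equivariant_embedding V2 V3 g ->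
  equivariant_embedding V1 V3 (g \o f).
Proof.
move=> nVH [f12 fM fJ f1] [g23 gM gJ g1].
split=> [x Vx | x y Vx Vy | x h Vx Hh | x Vx gf1] /=.
- exact/g23/f12.
- by rewrite fM // gM ?f12.
- by rewrite fJ // gJ ?f12.
by apply: (f1 _ Vx); apply: g1 gf1; apply: f12.
Qed.

Lemma equivariant_inj V1 V2 f : equivariant_embedding V1 V2 f ->
  {in V1 &, injective f}.
Proof.
case=> f12 fM _ f1 x y Vx Vy eqf; apply/eqP; rewrite eq_mulgV1; apply/eqP.
apply: f1; rewrite ?groupM ?groupV // fM ?groupV // eqf -fM ?groupV // mulgV.
by apply: (mulgI (f 1)); rewrite -fM ?mulg1.
Qed.

Lemma equivariant_image V1 V2 f : equivariant_embedding V1 V2 f ->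
  #|V1| = #|V2| -> f @: V1 = V2.
Proof.
move=> ef o12; have [f12 _ _ _] := ef; apply/eqP; rewrite eqEcard.
rewrite (card_in_imset (equivariant_inj ef)) o12 leqnn andbT.
by apply/subsetP=> _ /imsetP[x Vx ->]; apply: f12.
Qed.

Lemma equivariant_expg V1 V2 f n : equivariant_embedding V1 V2 f ->
  {in V1, forall x, f (x ^+ n) = f x ^+ n}.
Proof.
case=> _ fM _ _ x Vx; elim: n => [|n IHn]; last by rewrite !expgS fM ?groupX // IHn.
by apply: (mulgI (f 1)); rewrite -fM ?expg0 ?mulg1 ?group1.
Qed.

End Equivariant.

Section EquivariantRsim.

Import GRing.Theory.
Variables (p : nat) (gT : finGroupType) (H V1 V2 : {group gT}) (f : gT -> gT).
Hypotheses (ab1 : p.-abelem V1) (ab2 : p.-abelem V2).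
Hypotheses (nt1 : V1 :!=: 1) (nt2 : V2 :!=: 1).
Hypotheses (nV1 : H \subset 'N(V1)) (nV2 : H \subset 'N(V2)).
Hypotheses (ef : equivariant_embedding H V1 V2 f) (o12 : #|V1| = #|V2|).

Let phi (v : 'rV['F_p](V1)) : 'rV['F_p](V2) :=
  abelem_rV ab2 nt2 (f (rVabelem ab1 nt1 v)).

Let phi_linear : linear phi.
Proof.
have [f12 fM _ _] := ef.
have fX x n : x \in V1 -> f (x ^+ n) = f x ^+ n.
  exact: equivariant_expg ef x.
move=> a u v; rewrite /phi rVabelemD rVabelemZ fM ?groupX ?mem_rVabelem //.
rewrite abelem_rV_M ?f12 ?groupX ?mem_rVabelem // fX ?mem_rVabelem //.
by rewrite abelem_rV_X ?f12 ?mem_rVabelem // natr_Zp.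
Qed.

HB.instance Definition _ := GRing.isSemilinear.Build 'F_p _ _ _ phi
  (GRing.semilinear_linear phi_linear).

(** An additive map between vector spaces over 'F_p is linear, so f is given by a
matrix. *)
Lemma equivariant_rsim :
  mx_rsim (abelem_repr ab1 nt1 nV1) (abelem_repr ab2 nt2 nV2).
Proof.
have [f12 fM fJ f1] := ef.
exists (lin1_mx phi).
- by rewrite (dim_abelemE ab1) // (dim_abelemE ab2) // o12.
- apply: inj_row_free => v; rewrite mul_rV_lin1 /= /phi => phi0.
  have fv1 : f (rVabelem ab1 nt1 v) = 1.
    have Vfv := f12 _ (mem_rVabelem ab1 nt1 v).
    by apply: (@abelem_rV_inj p _ _ ab2 nt2 _ _ Vfv (group1 V2)); rewrite phi0 abelem_rV_1.
  apply: (@rVabelem_inj _ _ _ ab1 nt1).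
  by rewrite rVabelem0 (f1 _ (mem_rVabelem ab1 nt1 v)).
have phiE v : (v *m lin1_mx phi)%R = phi v by rewrite mul_rV_lin1.
move=> h Hh; apply/row_matrixP=> i; rewrite !rowE !mulmxA !phiE.
rewrite /phi rVabelemJ // fJ ?mem_rVabelem //.
by rewrite (abelem_rV_J ab2 nt2 nV2) ?f12 ?mem_rVabelem.
Qed.

End EquivariantRsim.

(** * The partial Pi-property of a p-subgroup *)

Section Hit.

Variables (p : nat) (gT : finGroupType) (G P : {group gT}).
Implicit Types (K U V : {group gT}).
Hypothesis sylP : p.-Sylow(G) P.

Let sPG : P \subset G := pHall_sub sylP.
Let pP : p.-group P := pHall_pgroup sylP.

(** U / V is the first factor of the chief series that contains x.  The core in G of
Q = V (P :&: U) contains A = V (K :&: U), because every conjugate of A is a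
conjugate under P, which normalises Q. *)
Lemma partial_Pi_hit K x : partial_Pi K G -> K \subset P -> x \in K -> x != 1 ->
  exists V U : {group gT},
    [/\ chief_factor G V U, x \in U, x \notin V, p.-group (U / V)
      & 'N_G(V <*> (K :&: U)) * P = G].
Proof.
case=> s [chs lasts PiK] sKP Kx ntx.
have Gx: x \in G by rewrite (subsetP sPG) ?(subsetP sKP).
pose i := find (fun U : {group gT} => x \in U) s.
have has_x: has (fun U : {group gT} => x \in U) s.
  apply/hasP; exists G => //; have := mem_last 1%G s.
  rewrite lasts inE => /predU1P[G1 |//].
  by case/negP: ntx; have := Gx; rewrite G1 inE.
have lti: i < size s by rewrite -has_find.
pose V := nth 1%G (1%G :: s) i; pose U := nth 1%G s i.
have chVU: chief_factor G V U by have /(pathP 1%G) := chs; apply.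
have Ux: x \in U by have := nth_find 1%G has_x.
have V'x: x \notin V.
  rewrite /V; case def_i: i => [|j] /=; first by rewrite inE.
  have ltji: j < i by rewrite def_i.
  by have := before_find 1%G ltji => /= ->.
exists V, U; have [nsVG nsUG prVU] := chief_factor_context chVU.
have [sVU nVG] := (proper_sub prVU, normal_norm nsVG).
pose A := (V <*> (K :&: U))%G; have sVA: V \subset A := joing_subl _ _.
have nVK: K \subset 'N(V) := subset_trans (subset_trans sKP sPG) nVG.
have nVKU: K :&: U \subset 'N(V) by rewrite subIset ?nVK.
have defA: A :=: V * (K :&: U) by rewrite /= norm_joinEr.
have sAU: A \subset U by rewrite /= join_subG sVU subsetIr.
have sUG := normal_sub nsUG.
have nsVA: V <| A by rewrite /normal sVA (subset_trans sAU) ?(subset_trans sUG).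
(* The index of the normaliser of A is a p-number, as A / V is a p-group. *)
have NAP: 'N_G(A) * P = G.
  apply: (coprime_index_mulG _ sPG); first exact: subsetIl.
  have [_ _ p'GP] := and3P sylP; apply: pnat_coprime p'GP.
  have:= PiK i lti; cbv zeta; rewrite -/V -/U.
  rewrite -quotientIG // (setIC _ (gval U)).
  rewrite -(group_modr _ sVU) (setIC (gval U) K) (normC nVKU) -defA.
  rewrite -quotient_subnormG // index_quotient_eq ?subsetIl //; last first.
    by rewrite setIS // (subset_trans sVA) ?normG.
  apply: sub_in_pnat => q _; rewrite mem_primes => /and3P[q_pr _].
  have: p.-group (A / V).
    by rewrite /= quotientYidl // quotient_pgroup // (pgroupS _ pP) // subIset ?sKP.
  by move=> /pgroupP/(_ q q_pr).
split=> //; pose Q := (V <*> (P :&: U))%G.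
have nVP: P \subset 'N(V) := subset_trans sPG nVG.
have nVPU: P :&: U \subset 'N(V) by rewrite subIset ?nVP.
have sAQ: A \subset Q by rewrite /= /Q genS ?setUS ?setSI.
have nQP: P \subset 'N(Q).
  by rewrite normsY // normsI ?normG // (subset_trans sPG) ?normal_norm.
have sQU: Q \subset U by rewrite join_subG sVU subsetIr.
suff <-: gcore Q G = U.
  apply: pgroupS (quotientS _ (gcore_sub _ _)) _.
  by rewrite /= quotientYidl // quotient_pgroup // (pgroupS _ pP) ?subsetIl.
have sAC: A \subset gcore Q G.
  apply/bigcapsP=> g /groupVr; rewrite -sub_conjgV -{1}NAP.
  case/mulsgP=> n u /setIP[_ Nn] Pu ->.
  by rewrite conjsgM (normP Nn) -(normsP nQP u Pu) conjSg.
apply: (@chief_factor_sub _ _ _ _ (gcore_group Q G) chVU);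
  rewrite ?gcore_norm ?(subset_trans sVA) //.
  exact: subset_trans (gcore_sub _ _) sQU.
apply/subsetPn; exists x => //; apply: (subsetP sAC).
by rewrite (subsetP (joing_subr _ _)) // inE Kx.
Qed.

End Hit.

Section PartialPi.

Variables (p : nat) (gT : finGroupType) (G P : {group gT}).
Implicit Types (K M N T U V X : {group gT}).
Hypotheses (p_pr : prime p) (sylP : p.-Sylow(G) P) (Op'G1 : 'O_p^'(G) = 1).
Hypothesis PiP : forall K,
  K \subset P -> #|K| = (p ^ 2)%N -> partial_Pi K G.

Let sPG : P \subset G := pHall_sub sylP.
Let pP : p.-group P := pHall_pgroup sylP.

(** * Groups with a normal subgroup of order p *)

Section NormalOrderP.

Variable N : {group gT}.
Hypotheses (nsNG : N <| G) (oN : #|N| = p).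

Let B := scalar_kernel_group p G.
Let Y := p_residual_group p B.
Let nsBG : B <| G := scalar_kernel_normal p G.
Let sYB : Y \subset B := p_residual_sub p B.
Let nYG : G \subset 'N(Y).
Proof. exact: subset_trans (normal_norm nsBG) (p_residual_norm p B). Qed.
Let nsYG : Y <| G.
Proof. by rewrite /normal nYG (subset_trans sYB) ?normal_sub. Qed.

Let sNP : N \subset P.
Proof.
apply: subset_trans (pcore_sub_Hall sylP); apply: pcore_max => //.
by rewrite /pgroup oN pnat_id.
Qed.

(** The subgroup to which [partial_Pi_hit] is applied is <[y]> or N <*> <[y]>,
according to the order of y.  In the second case N does not contain y, since Y
centralises N, and N affects the conclusion only if N covers the same
factor U / V, which then has order p and equals the image of <[y]>. *)
Lemma hit_line y : y \in P -> y ^+ (p ^ 2) = 1 -> ~~ (Y \subset 'C[y]) ->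
  exists V U, [/\ chief_factor G V U, y \in U, y \notin V, p.-group (U / V)
      & 'N_G(V <*> <[y]>) * P = G].
Proof.
move=> Py y1 ncY.
have nty: y != 1 by apply: contraNneq ncY => ->; rewrite cent11T subsetT.
have cYN: Y \subset 'C(N).
  apply: subset_trans sYB _; apply: scalar_kernel_cent_prime oN _ => //.
  exact: normal_norm.
have N'y: y \notin N.
  by apply: contra ncY => Ny; rewrite -cent_set1 (subset_trans cYN) ?centS ?sub1set.
have oy: #[y] = p \/ #[y] = (p ^ 2)%N.
  have: #[y] %| p ^ 2 by rewrite order_dvdn y1.
  case/(dvdn_pfactor _ _ p_pr)=> [[|[|[|k]]]] //= _ => [/eqP|->|->].
  - by rewrite expn0 order_eq1 (negPf nty).
  - by left.
  - by right.
case: oy => oy; last first.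
  have sKP: <[y]> \subset P by rewrite cycle_subG.
  have [V [U [chVU Uy V'y pUV defG]]] :=
    partial_Pi_hit sylP (PiP sKP oy) sKP (cycle_id y) nty.
  exists V, U; split=> //.
  have syU : <[y]> \subset U by rewrite cycle_subG.
  by rewrite /= (setIidPl syU) in defG.
pose K := (N <*> <[y]>)%G.
have nNy: <[y]> \subset 'N(N).
  by rewrite cycle_subG (subsetP (normal_norm nsNG)) ?(subsetP sPG).
have tiNy: N :&: <[y]> = 1.
  by rewrite setIC prime_TIg -?orderE ?oy // cycle_subG.
have oK: #|K| = (p ^ 2)%N.
  by rewrite /= norm_joinEr // TI_cardMg // oN -orderE oy.
have sKP: K \subset P by rewrite join_subG sNP cycle_subG.
have Ky: y \in K by rewrite (subsetP (joing_subr _ _)) ?cycle_id.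
have [V [U [chVU Uy V'y pUV defG]]] :=
  partial_Pi_hit sylP (PiP sKP oK) sKP Ky nty.
exists V, U; split=> //.
have [nsVG nsUG prVU] := chief_factor_context chVU.
have [nVG nUG] := (normal_norm nsVG, normal_norm nsUG).
have prN : prime #|N| by rewrite oN.
have defK : K :=: N * <[y]> by rewrite /= norm_joinEr.
have syU : <[y]> \subset U by rewrite cycle_subG.
(* If U does not contain N, then K :&: U is <[y]>. *)
have [sNU | /(prime_TIg prN) tiNU] := boolP (N \subset U); last first.
  by rewrite defK (setIC (N * _)) -group_modr // (setIC (gval U)) tiNU mul1g in defG.
have sKU: K \subset U by rewrite join_subG sNU.
rewrite (setIidPl sKU) in defG.
have [sNV | nsNV] := boolP (N \subset V).
  by rewrite joingA (joing_idPl sNV) in defG.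
have tiNV : N :&: V = 1 by apply: prime_TIg.
have defU : V <*> N = U.
  apply: (@chief_factor_sub _ _ _ _ (V <*> N)%G chVU).
  - by rewrite normsY ?(normal_norm nsNG).
  - exact: joing_subl.
  - by rewrite join_subG proper_sub.
  by apply: contra nsNV; apply: subset_trans (joing_subr _ _).
have oUV : #|U / V| = p.
  rewrite -defU /= quotientYidl ?(subset_trans (normal_sub nsNG)) //.
  rewrite -oN; apply: esym; apply/card_isog/quotient_isog; last by rewrite setIC.
  exact: subset_trans (normal_sub nsNG) nVG.
have nVy : <[y]> \subset 'N(V).
  by rewrite cycle_subG (subsetP nVG) ?(subsetP sPG).
have defA : V <*> <[y]> = U.
  apply/eqP; rewrite eqEsubset join_subG (proper_sub prVU) syU /=.
  rewrite norm_joinEr // -quotientSK ?(subset_trans (normal_sub nsUG)) //.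
  have sq : <[y]> / V \subset U / V by apply: quotientS.
  have [|//|tiq] := @prime_subgroupVti _ (U / V)%G (<[y]> / V)%G.
    by rewrite oUV.
  have Ny : y \in 'N(V) by rewrite -cycle_subG.
  case/negP: V'y; apply: coset_idr => //; apply/set1P.
  by rewrite -[[set 1]]/(1 : {set coset_of V}) -tiq inE !mem_quotient ?cycle_id.
by rewrite defA (setIidPl nUG) mulGSid.
Qed.

(** Let T be minimal among the normal subgroups that contain a counterexample, and
let U / V be the factor at which it appears.  By minimality Y centralises the small
elements of T :&: V, so [Ito_pgroup] applies to T :&: V :&: Y, and
T :&: B, hence T, is a p-group.  Next, T equals its characteristic subgroup from
[char_subgroup_exponent_p2], so all its elements are small.  This allows to choose
an element y outside C = 'C_T(Y) which P fixes modulo C: then P normalises V <[y]>,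
so U / V has order p, B centralises it, and Y centralises T. *)
Lemma cent_small_elt x : x \in P -> x ^+ (p ^ 2) = 1 -> Y \subset 'C[x].
Proof.
move=> Px x1; apply: contraT => ncx.
pose bad (T : {group gT}) := (T <| G) &&
  [exists x in T :&: P, (x ^+ (p ^ 2) == 1) && ~~ (Y \subset 'C[x])].
have [|T /mingroupP[/andP[nsTG /exists_inP[{Px x1 ncx}x]]]] := @ex_mingroup _ bad.
  exists G; rewrite /bad normal_refl; apply/exists_inP; exists x.
    by rewrite inE (subsetP sPG).
  by rewrite x1 eqxx.
case/setIP=> Tx Px /andP[/eqP x1 ncx] minT.
have [sTG nTG] := andP nsTG.
(* No proper normal subgroup of T contains a counterexample, even outside P:
   it could be conjugated into P. *)
have min M : M <| G -> M \subset T -> M :!=: T ->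
  {in M, forall y, y ^+ (p ^ 2) = 1 -> Y \subset 'C[y]}.
  move=> nsMG sMT neMT y My y1; apply: contraR neMT => ncy.
  have Gy := subsetP (normal_sub nsMG) y My.
  have py : p.-elt y := p_elt_expg_p2 p_pr y1.
  have [g Gg Pyg] := p_elt_conj_Sylow sylP Gy py.
  apply/eqP/minT => //; rewrite /bad nsMG; apply/exists_inP; exists (y ^ g).
    by rewrite inE memJ_norm ?My // (subsetP (normal_norm nsMG)).
  rewrite -conjXg y1 conj1g eqxx /=; apply: contra ncy => cyg.
  by rewrite -(conjSg _ _ g) (normsP nYG g Gg) -normJ conjg_set1.
have inM M y : M <| G -> y \in T -> y \in M -> y ^+ (p ^ 2) = 1 ->
  ~~ (Y \subset 'C[y]) -> T \subset M.
  move=> nsMG Ty My y1; apply: contraR => nsTM.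
  apply: (min (T :&: M)%G); rewrite ?normalI ?subsetIl ?inE ?Ty //.
  by apply: contra nsTM => /eqP <-; apply: subsetIr.
have p_p'_1 w : p.-elt w -> p^'.-elt w -> w = 1.
  by move=> pw p'w; apply/eqP; rewrite -order_eq1 (pnat_1 pw p'w).
have pT: p.-group T.
  have [V [U [chVU Ux V'x pUV _]]] := hit_line Px x1 ncx.
  have [nsVG nsUG prVU] := chief_factor_context chVU.
  have sTU := inM U x nsUG Tx Ux x1 ncx.
  have neT1 : (T :&: V)%G :!=: T.
    by apply: contra V'x => /eqP defT; move: Tx; rewrite -defT => /setIP[].
  pose W := (T :&: V :&: Y)%G.
  have nsT1G : (T :&: V)%G <| G by apply: normalI.
  have nsWG : W <| G by apply: normalI.
  have pW: p.-group W.
    apply: (Ito_pgroup p_pr).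
      apply/trivgP; rewrite -Op'G1 pcore_max ?pcore_pgroup //.
      exact: char_normal_trans (pcore_char _ _) nsWG.
    move=> y /setIP[T1y Yy] y1.
    apply: subset_trans (p_residual_sub p W) _; apply: subset_trans (subsetIr _ _) _.
    exact: (min _ nsT1G (subsetIl _ _) neT1 y T1y y1).
  (* A p'-element of T :&: B lies in Y by definition of Y, and in V because
     T V / V is a p-group. *)
  have pTB: p.-group (T :&: B).
    apply: pgroup_elts => z /setIP[Tz Bz].
    suff: z.`_p^' = 1 by move/constt1P; rewrite p_eltNK.
    set w := z.`_p^'; have p'w : p^'.-elt w by apply: p_elt_constt.
    have Tw : w \in T by rewrite groupX.
    have Yw : w \in Y by rewrite mem_p_residual ?groupX.
    have Gw := subsetP sTG w Tw; have Nw := subsetP (normal_norm nsVG) w Gw.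
    have Vw : w \in V.
      apply: coset_idr => //; apply: (p_p'_1 _ (coset V w)); last exact: morph_p_elt.
      by apply: mem_p_elt pUV _; rewrite mem_quotient ?(subsetP sTU).
    by apply: p_p'_1 p'w; apply: mem_p_elt pW _; rewrite !inE Tw Vw.
  have Bx : x \in B.
    by apply: mem_scalar_kernel => //; [apply: mem_p_elt pP Px | apply: (subsetP sPG)].
  by apply: pgroupS pTB; rewrite subsetI subxx (inM B x).
have sTP: T \subset P.
  by apply: subset_trans (pcore_sub_Hall sylP); apply: pcore_max.
have p'cent w : w \in B -> p^'.-elt w -> p^'.-group <[w]> /\ <[w]> \subset Y.
  by move=> Bw p'w; split=> //; rewrite cycle_subG mem_p_residual.
have cYT' : ~~ (Y \subset 'C(T)).
  apply: contra ncx => cYT; rewrite -cent_set1 (subset_trans cYT) // centS //.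
  by rewrite sub1set.
(* Otherwise D is smaller than T, and minimality makes Y centralise D. *)
have expT : {in T, forall y, y ^+ (p ^ 2) = 1}.
  have [D [chD expD cDT]] := char_subgroup_exponent_p2 p_pr pT.
  have [<- // | neDT] := eqVneq (gval D) (gval T).
  case/negP: cYT'; rewrite gen_subG; apply/subsetP=> w /[!inE] /andP[Bw p'w].
  have [p'W sWY] := p'cent w Bw p'w.
  have Gw := subsetP (normal_sub nsBG) w Bw.
  rewrite -cycle_subG cDT ?cycle_subG ?(subsetP nTG) //.
  apply/centP=> d Dd; have nsDG := char_normal_trans chD nsTG.
  have := min D nsDG (char_sub chD) neDT d Dd (expD d Dd).
  by move/subsetP/(_ w (mem_p_residual Bw p'w))/cent1P/commute_sym.
pose C := 'C_T(Y)%G.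
have nsCG : C <| G.
  by rewrite /normal subIset ?sTG // normsI ?norms_cent.
have [sCT nCG] : C \subset T /\ G \subset 'N(C).
  by split; [apply: subsetIl | apply: normal_norm].
have memC y : y \in T -> (y \in C) = (Y \subset 'C[y]).
  by move=> Ty; rewrite inE Ty sub_cent1.
have C'x : x \notin C by rewrite memC.
(* The image of y is a nontrivial central element of P / C inside T / C. *)
have [y Ty [C'y sRC]]: exists2 y, y \in T & y \notin C /\ {in P, forall u, [~ y, u] \in C}.
  have nCP := subset_trans sPG nCG.
  have nsTP : T / C <| P / C by rewrite quotient_normal // /normal sTP (subset_trans sPG).
  have ntTC : T / C != 1.
    rewrite -subG1 (quotient_sub1 (subset_trans sTG nCG)).
    by apply/subsetPn; exists x.
  have := meet_center_nil (quotient_nil C (pgroup_nil pP)) nsTP ntTC.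
  case/trivgPn=> _ /setIP[/morphimP[y Ny Ty ->] /centerP[_ cyP]] nty.
  exists y => //; split; first by apply: contra nty => Cy; apply/eqP; apply: coset_id.
  move=> u Pu; have Nu := subsetP nCP u Pu.
  apply: coset_idr; rewrite ?groupR // morphR //.
  by apply/eqP/commgP/cyP; rewrite mem_quotient.
have ncy : ~~ (Y \subset 'C[y]) by rewrite -memC.
have y1 := expT y Ty; have Py := subsetP sTP y Ty.
have [V [U [chVU Uy V'y pUV defG]]] := hit_line Py y1 ncy.
have [nsVG nsUG prVU] := chief_factor_context chVU.
have [[sVG nVG] sVU] := (andP nsVG, proper_sub prVU).
have sTU := inM U y nsUG Ty Uy y1 ncy.
(* By minimality T :&: V lies in C; conversely C lies in V, as V C = U would
   put T inside C. *)
have sTVC : T :&: V \subset C.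
  apply/subsetP=> z TVz; have [Tz Vz] := setIP TVz; rewrite memC //.
  apply: (min (T :&: V)%G) => //; rewrite ?normalI ?subsetIl ?expT //.
  by apply: contra V'y => /eqP defT; move: Ty; rewrite -defT => /setIP[].
have sCV : C \subset V.
  apply: contraT => nsCV; have nVC : C \subset 'N(V).
    by rewrite (subset_trans sCT) ?(subset_trans sTG).
  have defU : (V <*> C)%G :=: U.
    apply: (chief_factor_sub chVU); rewrite ?normsY ?joing_subl //.
      by rewrite join_subG sVU (subset_trans sCT).
    by apply: contra nsCV; apply: subset_trans (joing_subr _ _).
  move: sTU; rewrite -defU /= norm_joinEr // => /setIidPl.
  rewrite -group_modr // => defT.
  have: T \subset C by rewrite -defT mul_subG.
  by move/subsetP/(_ x Tx); rewrite (negPf C'x).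
have defA : (V <*> <[y]>)%G :=: U.
  apply: (chief_factor_sub chVU); rewrite ?joing_subl //.
  - rewrite -defG mul_subG ?subsetIr //; apply/subsetP=> u Pu.
    rewrite inE conjYg -cycleJ (normsP nVG) ?(subsetP sPG) // join_subG joing_subl.
    rewrite cycle_subG conjg_mulR /= groupM //.
      by rewrite (subsetP (joing_subr _ _)) ?cycle_id.
    by rewrite (subsetP (joing_subl _ _)) ?(subsetP sCV) ?sRC.
  - by rewrite join_subG sVU cycle_subG.
  by apply/subsetPn; exists y; rewrite // (subsetP (joing_subr _ _)) ?cycle_id.
have oUV : #|U / V| = p.
  have [abUV ntUV] := chief_pgroup_abelem chVU pUV.
  have nVy : <[y]> \subset 'N(V) by rewrite cycle_subG (subsetP nVG) ?(subsetP sPG).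
  have: cyclic (U / V) by rewrite -defA /= quotientYidl // quotient_cyclic ?cycle_cyclic.
  rewrite (abelem_cyclic abUV) => le1; rewrite (card_pgroup pUV).
  have: 0 < logn p #|U / V|.
    rewrite lt0n; apply: contra ntUV => /eqP l0.
    by rewrite trivg_card1 (card_pgroup pUV) l0.
  by move: le1; case: logn => [|[|]].
have sRV : [~: T, Y] \subset C.
  apply: subset_trans sTVC; rewrite subsetI commg_subl (subset_trans (normal_sub nsYG)) //=.
  apply: subset_trans (scalar_kernel_comm_chief p_pr chVU oUV).
  exact: commgSS.
case/negP: cYT'; rewrite gen_subG; apply/subsetP=> w /[!inE] /andP[Bw p'w].
have [p'W sWY] := p'cent w Bw p'w.
rewrite -cycle_subG; apply: coprime_cent_commg.
- by rewrite (subset_trans sWY) // (subset_trans (normal_sub nsYG)).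
- exact: pnat_coprime pT p'W.
apply: subset_trans (commgS _ sWY) _; apply: subset_trans sRV _.
by rewrite subIset // centS ?orbT.
Qed.

(** [Ito_pgroup] makes the p-residual of the scalar kernel a p-group. *)
Lemma scalar_kernel_Sylow : scalar_kernel p G = P.
Proof.
have pY : p.-group Y.
  apply: (Ito_pgroup p_pr) => [|y Yy y1].
    apply/trivgP; rewrite -Op'G1 pcore_max ?pcore_pgroup //.
    exact: char_normal_trans (pcore_char _ _) nsYG.
  apply: subset_trans (p_residual_sub p Y) _.
  have Gy := subsetP (normal_sub nsYG) y Yy.
  have py : p.-elt y := p_elt_expg_p2 p_pr y1.
  have [g Gg Pyg] := p_elt_conj_Sylow sylP Gy py.
  rewrite -(conjSg _ _ g) (normsP (normal_norm nsYG) g Gg) -normJ conjg_set1.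
  apply: (cent_small_elt Pyg).
  by rewrite -conjXg y1 conj1g.
have pB : p.-group B.
  apply: pgroup_elts => z Bz.
  suff: z.`_p^' = 1 by move/constt1P; rewrite p_eltNK.
  have p'w := p_elt_constt p^' z.
  have Yw : z.`_p^' \in Y by rewrite mem_p_residual ?groupX.
  by apply/eqP; rewrite -order_eq1 (pnat_1 (mem_p_elt pY Yw) p'w).
apply/eqP; rewrite eqEsubset; apply/andP; split.
  by apply: subset_trans (pcore_sub_Hall sylP); apply: pcore_max.
apply/subsetP=> x Px; rewrite mem_scalar_kernel ?(subsetP sPG) //.
exact: mem_p_elt pP Px.
Qed.

Lemma prime_normal_supersoluble : P <| G /\ p_supersoluble p G.
Proof.
have nsPG : P <| G by rewrite -scalar_kernel_Sylow scalar_kernel_normal.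
split=> //; apply: (p_supersoluble_scalar_kernel p_pr sylP nsPG).
by rewrite scalar_kernel_Sylow.
Qed.

End NormalOrderP.

(** * Groups without normal subgroups of order p *)

Section NoNormalOrderP.

Hypothesis leP : (p ^ 2 <= #|P|)%N.

Let p2_gt1 : 1 < p ^ 2.
Proof. by rewrite -(expn0 p) ltn_exp2l ?prime_gt1. Qed.

(** K has to meet X nontrivially.  Take x of order p in X and in the centre of P,
and a normal subgroup of P of order p ^ 2 that either contains x or provides a
second element of order p to join with x. *)
Lemma exists_p2_subgroup X : X <| P -> X :!=: 1 ->
  exists K, exists2 x, [/\ K \subset P & #|K| = (p ^ 2)%N]
    & [/\ x \in K, x \in X & x != 1].
Proof.
move=> nsXP ntX.
have logP: 2 <= logn p #|P| by rewrite -(leq_exp2l _ _ (prime_gt1 p_pr)) -card_pgroup.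
have [K0 [_ nsK0P oK0]] := normal_pgroup pP (normal_refl P) logP.
have central (Y : {group gT}) : Y <| P -> Y :!=: 1 ->
  exists2 x, x \in Y :&: 'Z(P) & #[x] = p.
  move=> nsYP ntY; have ntYZ := meet_center_nil (pgroup_nil pP) nsYP ntY.
  have pYZ: p.-group (Y :&: 'Z(P)).
    by apply: pgroupS pP; rewrite subIset // (normal_sub nsYP).
  by have [_ /(Cauchy p_pr)[x]] := pgroup_pdiv pYZ ntYZ; exists x.
have [x /setIP[Xx /setIP[Px cxP]] ox] := central X nsXP ntX.
have ntx: x != 1 by rewrite -order_gt1 ox prime_gt1.
have [K0x | K0'x] := boolP (x \in K0).
  by exists K0, x; split=> //; apply: normal_sub.
have ntK0: K0 :!=: 1 by rewrite -cardG_gt1 oK0 p2_gt1.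
have [z /setIP[K0z /setIP[Pz _]] oz] := central K0 nsK0P ntK0.
have cxz: <[z]> \subset 'C(<[x]>).
  by rewrite cent_cycle cycle_subG; apply/cent1P; apply: commute_sym; apply: (centP cxP).
exists (<[x]> <*> <[z]>)%G, x; split=> //.
- by rewrite join_subG !cycle_subG Px.
- rewrite /= cent_joinEr // TI_cardMg -?orderE ?ox ?oz //.
  apply: prime_TIg; rewrite -?orderE ?ox // cycle_subG.
  by apply: contra K0'x; apply: subsetP; rewrite cycle_subG.
by rewrite (subsetP (joing_subl _ _)) ?cycle_id.
Qed.

Lemma minnormal_pgroup N : minnormal N G -> N \subset G -> p.-group N.
Proof.
move=> minN sNG; have /andP[ntN nNG] := mingroupp minN.
have nsNG: N <| G by rewrite /normal sNG.
have nsNP: (N :&: P)%G <| P by rewrite /= setIC (normalGI sPG).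
have [|K [x [sKP oK] [Kx /setIP[Nx _] ntx]]] := exists_p2_subgroup nsNP.
  apply: contra ntN => /eqP NP1; rewrite -subG1 -Op'G1 pcore_max //.
  rewrite -partG_eq1 -(card_Hall (Sylow_setI_normal nsNG sylP)).
  by rewrite NP1 cards1.
have [V [U [chVU Ux V'x pUV _]]] := partial_Pi_hit sylP (PiP sKP oK) sKP Kx ntx.
have [_ _ _ isoN] := minnormal_chief minN sNG chVU Nx Ux V'x.
by rewrite (isog_pgroup _ isoN).
Qed.

(** Otherwise N has a subgroup K of order p ^ 2 normal in P; then V K is normal in
G for the factor U / V covered by N, whence N = K. *)
Lemma minnormal_card N : minnormal N G -> N \subset G -> (#|N| <= p ^ 2)%N.
Proof.
move=> minN sNG; have pN := minnormal_pgroup minN sNG.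
have /andP[ntN nNG] := mingroupp minN.
have nsNG: N <| G by rewrite /normal sNG.
have sNP: N \subset P.
  by apply: subset_trans (pcore_sub_Hall sylP); apply: pcore_max.
rewrite leqNgt; apply/negP=> ltpN.
have logN: 2 <= logn p #|N|.
  by rewrite -(leq_exp2l _ _ (prime_gt1 p_pr)) -card_pgroup // ltnW.
have [K [sKN nsKP oK]] := normal_pgroup pP (normalS sNP sPG nsNG) logN.
have sKP := normal_sub nsKP.
have [x Kx ntx]: exists2 x, x \in K & x != 1.
  by apply/trivgPn; rewrite -cardG_gt1 oK p2_gt1.
have Nx := subsetP sKN x Kx.
have [V [U [chVU Ux V'x pUV defG]]] := partial_Pi_hit sylP (PiP sKP oK) sKP Kx ntx.
have [sNU tiNV defU _] := minnormal_chief minN sNG chVU Nx Ux V'x.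
have [nsVG nsUG prVU] := chief_factor_context chVU.
have [sVG nVG] := andP nsVG.
have [sKU nVK]: K \subset U /\ K \subset 'N(V).
  by split; [apply: subset_trans sNU | rewrite (subset_trans sKN) ?(subset_trans sNG)].
rewrite (setIidPl sKU) in defG.
have nAG: G \subset 'N(V <*> K).
  rewrite -defG mul_subG ?subsetIr // normsY ?(normal_norm nsKP) //.
  exact: subset_trans nVG.
have defA: (V <*> K)%G :=: U.
  apply: (chief_factor_sub chVU) => //; first exact: joing_subl.
    by rewrite join_subG proper_sub.
  by apply/subsetPn; exists x; rewrite // (subsetP (joing_subr _ _)).
have: N \subset V * K by rewrite -norm_joinEr // defA.
move/setIidPl; rewrite -group_modr // tiNV mul1g.
by move=> defN; rewrite -defN oK ltnn in ltpN.
Qed.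

Lemma sub_minnormal_Sylow N : minnormal N G -> N \subset G -> N \subset P.
Proof.
move=> minN sNG; apply: subset_trans (pcore_sub_Hall sylP).
apply: pcore_max (minnormal_normal minN sNG).
exact: minnormal_pgroup.
Qed.

Hypothesis no_normal_p : forall N, N <| G -> #|N| != p.

Lemma card_minnormal N : minnormal N G -> N \subset G -> #|N| = (p ^ 2)%N.
Proof.
move=> minN sNG; have pN := minnormal_pgroup minN sNG.
have := minnormal_card minN sNG.
have /andP[ntN nNG] := mingroupp minN.
have := no_normal_p (minnormal_normal minN sNG).
rewrite (card_pgroup pN); case: logn (card_pgroup pN) => [|[|[|k]]] //.
- by move=> oN; rewrite expn0 in oN; rewrite trivg_card1 oN in ntN.
- by rewrite expn1 eqxx.
by rewrite leq_exp2l ?prime_gt1.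
Qed.

(** To see that U / V has order p ^ 2, take M normal in G and maximal subject to
containing V and not y.  Then U :&: M = V, and some minimal normal subgroup N is not
inside M since y is in the socle; U M = N M follows, so U / V is isomorphic to N.
Now [chief_p2_subgroup] shows that K covers U / V, and comparing orders K
meets V trivially. *)
Lemma gsocle_hit K y : K \subset P -> #|K| = (p ^ 2)%N -> y \in K -> y != 1 ->
  y \in gsocle G ->
  exists V U, [/\ chief_factor G V U, y \in U /\ y \notin V,
    p.-group (U / V) /\ #|U / V| = (p ^ 2)%N, V <*> K = U & K :&: V = 1].
Proof.
move=> sKP oK Ky nty Sy.
have [V [U [chVU Uy V'y pUV defG]]] := partial_Pi_hit sylP (PiP sKP oK) sKP Ky nty.
have [nsVG nsUG prVU] := chief_factor_context chVU.
have [[sVG nVG] sVU] := (andP nsVG, proper_sub prVU).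
have [sUG nUG] := andP nsUG; have nVU := subset_trans sUG nVG.
have nVK := subset_trans (subset_trans sKP sPG) nVG.
exists V, U.
have oUV : #|U / V| = (p ^ 2)%N.
  pose gM (M : {group gT}) := [&& M <| G, V \subset M & y \notin M].
  have [|M /maxgroupP[/and3P[nsMG sVM M'y] maxM] _] := @maxgroup_exists _ gM V.
    by rewrite /gM nsVG subxx.
  have [sMG nMG] := andP nsMG.
  have tiUM : U :&: M = V.
    apply/eqP; rewrite eqEsubset subsetI sVU sVM andbT; apply: contraT => nsUM.
    have defU : (U :&: M)%G :=: U.
      apply: (chief_factor_sub chVU).
      - exact: normsI.
      - by rewrite subsetI sVU.
      - exact: subsetIl.
      by rewrite andbT in nsUM.
    by move: Uy; rewrite -defU inE (negPf M'y) andbF.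
  have [N [minN sNG nsNM]] : exists N, [/\ minnormal N G, N \subset G & ~~ (N \subset M)].
    by apply: gsocle_nsub; apply: contra M'y => /subsetP->.
  have nMN := subset_trans sNG nMG; have nMU := subset_trans sUG nMG.
  have nNG := normal_norm (minnormal_normal minN sNG).
  have MNy : y \in M <*> N.
    apply: contraR nsNM => M'Ny; rewrite -(maxM (M <*> N)%G) ?joing_subl ?joing_subr //.
    rewrite /gM M'Ny (subset_trans sVM) ?joing_subl // andbT /normal.
    by rewrite join_subG sMG sNG normsY.
  have sUMN : U \subset M <*> N.
    apply/setIidPl; apply: (@chief_factor_sub _ _ _ _ (U :&: (M <*> N))%G chVU).
    - by rewrite normsI ?normsY.
    - by rewrite subsetI sVU (subset_trans sVM) ?joing_subl.
    - exact: subsetIl.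
    by apply/subsetPn; exists y; rewrite // inE Uy.
  rewrite norm_joinEr // in MNy sUMN.
  have tiNM : N :&: M = 1 := minnormal_TI minN nMG nsNM.
  have sNMU : N \subset M * U.
    rewrite -norm_joinEr //; apply: (minnormal_sub minN); first exact: normsY.
    case/mulsgP: MNy => m n Mm Nn def_y; apply/trivgPn; exists n.
      rewrite inE Nn /= -(mulKg m n) -def_y norm_joinEr //.
      by rewrite mem_mulg ?groupV.
    by apply: contraNneq M'y => n1; rewrite def_y n1 mulg1.
  have eqUN : U / M = N / M by apply/eqP; rewrite eqEsubset !quotientSK // sUMN.
  have isoU := second_isog nMU; rewrite setIC tiUM eqUN in isoU.
  have isoN := quotient_isog nMN; rewrite setIC in isoN.
  by rewrite (card_isog isoU) -(card_isog (isoN tiNM)) card_minnormal.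
(* By orders, K :&: U has a trivial intersection with V and is all of K. *)
pose A := (V <*> (K :&: U))%G.
have nVKU : K :&: U \subset 'N(V) by rewrite subIset ?nVK.
have defA : A :=: U.
  apply: (chief_p2_subgroup p_pr pP sPG chVU oUV) => //.
  - exact: joing_subl.
  - by rewrite join_subG sVU subsetIr.
  by apply/subsetPn; exists y; rewrite // (subsetP (joing_subr _ _)) // inE Ky.
have defUV : U / V = (K :&: U) / V.
  by rewrite -[in LHS]defA /= quotientYidl.
have oKUV : (#|K :&: U : V :&: (K :&: U)| = p ^ 2)%N.
  by rewrite -oUV defUV card_quotient // (setIC (gval V)) indexgI.
have := Lagrange (subsetIr V (K :&: U)); rewrite oKUV => oKU.
have leKU : #|K :&: U| <= p ^ 2 by rewrite -oK subset_leq_card ?subsetIl.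
have V1 : #|V :&: (K :&: U)| = 1%N.
  apply/eqP; rewrite eqn_leq cardG_gt0 andbT.
  by rewrite -(leq_pmul2r (_ : 0 < p ^ 2)) ?mul1n ?oKU // expn_gt0 prime_gt0.
rewrite V1 mul1n in oKU.
have sKU : K \subset U.
  by apply/setIidPl/eqP; rewrite eqEcard subsetIl oK -oKU leqnn.
split=> //; first by rewrite -[in RHS]defA /= (setIidPl sKU).
by apply/eqP; rewrite trivg_card1 /= setIC -{1}(setIidPl sKU) V1.
Qed.

(** Let T be minimal among the normal subgroups containing a counterexample x, let
N be minimal normal inside T, and y in N commute with x.  From [gsocle_hit] for
K = <x, y> we get x = m n with n in N and m in V :&: T of order dividing p; as T :&: V is
smaller than T, m is in the socle, and so is x. *)
Lemma prime_order_gsocle x : x \in P -> x ^+ p = 1 -> x \in gsocle G.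
Proof.
move=> Px x1; apply: contraT => nSx.
pose bad (T : {group gT}) := (T <| G) &&
  [exists x in T :&: P, (x ^+ p == 1) && (x \notin gsocle G)].
have [|T /mingroupP[/andP[nsTG /exists_inP[{Px x1 nSx}x]]]] := @ex_mingroup _ bad.
  exists G; rewrite /bad normal_refl; apply/exists_inP; exists x.
    by rewrite inE (subsetP sPG).
  by rewrite x1 eqxx.
case/setIP=> Tx Px /andP[/eqP x1 nSx] minT; have [sTG nTG] := andP nsTG.
have ntx : x != 1 by apply: contraNneq nSx => ->; rewrite group1.
have ox : #[x] = p by apply: nt_prime_order.
have [||N minN sNT] := @minnormal_exists _ G T; rewrite // ?nTG //.
  by apply/trivgPn; exists x.
have sNG := subset_trans sNT sTG; have sNP := sub_minnormal_Sylow minN sNG.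
have nsNG := minnormal_normal minN sNG; have [_ nNG] := andP nsNG.
have pN := pgroupS sNP pP; have /andP[ntN _] := mingroupp minN.
have abN : p.-abelem N.
  have [_ _] := minnormal_solvable minN (subxx _) (pgroup_sol pN).
  by rewrite (is_abelem_pgroup pN).
have expN := abelem_order_p abN.
pose Q := (N <*> <[x]>)%G.
have pQ : p.-group Q by apply: pgroupS pP; rewrite join_subG sNP cycle_subG.
have nNx : <[x]> \subset 'N(N) by rewrite cycle_subG (subsetP nNG) ?(subsetP sPG).
have nsNQ : N <| Q by rewrite /normal joing_subl join_subG normG.
have := meet_center_nil (pgroup_nil pQ) nsNQ ntN.
case/trivgPn=> y /setIP[Ny /centerP[_ cyQ]] nty.
have oy := expN y Ny nty.
have N'x : x \notin N by apply: contra nSx; apply: subsetP (minnormal_gsocle minN sNG) _.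
have cxy : <[y]> \subset 'C(<[x]>).
  rewrite cent_cycle cycle_subG; apply/cent1P.
  by apply: cyQ; rewrite (subsetP (joing_subr _ _)) ?cycle_id.
pose K := (<[x]> <*> <[y]>)%G.
have sKP : K \subset P by rewrite join_subG !cycle_subG Px (subsetP sNP).
have oK : #|K| = (p ^ 2)%N.
  rewrite /= cent_joinEr // TI_cardMg -?orderE ?ox ?oy //.
  apply: prime_TIg; rewrite -?orderE ?ox // cycle_subG; apply: contra N'x.
  by apply: subsetP; rewrite cycle_subG.
have Ky : y \in K by rewrite (subsetP (joing_subr _ _)) ?cycle_id.
have Sy := subsetP (minnormal_gsocle minN sNG) y Ny.
have [V [U [chVU [Uy V'y] _ defU _]]] := gsocle_hit sKP oK Ky nty Sy.
have [nsVG nsUG prVU] := chief_factor_context chVU.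
have [_ tiNV defU' _] := minnormal_chief minN sNG chVU Ny Uy V'y.
have : x \in V * N.
  rewrite defU' -defU (subsetP (joing_subr _ _)) //.
  by rewrite (subsetP (joing_subl _ _)) ?cycle_id.
case/mulsgP=> m n Vm Nn def_x.
have cmn : commute m n.
  have cVN : [~: V, N] \subset V :&: N.
    apply: commg_subI; rewrite subsetI subxx /=.
      exact: subset_trans (normal_sub nsVG) nNG.
    exact: subset_trans sNG (normal_norm nsVG).
  have := subsetP cVN _ (mem_commg Vm Nn); rewrite setIC tiNV => /set1P cmn1.
  by apply/commgP/eqP.
have def_m : m = x * n^-1 by rewrite def_x mulgK.
have m1 : m ^+ p = 1.
  have [_ expN1] := abelemP p_pr abN.
  by move: x1; rewrite def_x expgMn // (expN1 n Nn) mulg1.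
have Pm : m \in P by rewrite def_m (groupM Px) // groupV (subsetP sNP).
have Tm : m \in T by rewrite def_m (groupM Tx) // groupV (subsetP sNT).
have nSm : m \notin gsocle G.
  apply: contra nSx => Sm; rewrite def_x groupM //.
  exact: subsetP (minnormal_gsocle minN sNG) n Nn.
have defT : (T :&: V)%G :=: T.
  apply: minT; rewrite ?subsetIl // /bad normalI //=; apply/exists_inP.
  by exists m; rewrite ?inE ?Tm ?Vm // m1 eqxx.
have : N :&: V = N by apply/setIidPl; rewrite (subset_trans sNT) // -defT subsetIr.
by rewrite tiNV => N1; rewrite -N1 eqxx in ntN.
Qed.

(** For z of order p ^ 2, [gsocle_hit] with K = <[z]> and the element z ^+ p of the
socle gives a chief factor that is both elementary abelian and cyclic of order
p ^ 2. *)
Lemma Sylow_exponent x : x \in P -> x ^+ p = 1.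
Proof.
have no_p2 z : z \in P -> #[z] != (p ^ 2)%N.
  move=> Pz; apply/eqP => oz; pose y := z ^+ p.
  have ntz : y != 1.
    by rewrite -order_dvdn oz gtnNdvd ?prime_gt0 // ltn_Pmulr ?prime_gt1 ?prime_gt0.
  have Sy : y \in gsocle G.
    by rewrite prime_order_gsocle ?groupX // -expgM mulnn -oz expg_order.
  have szP : <[z]> \subset P by rewrite cycle_subG.
  have [V [U [chVU _ [pUV oUV] defU _]]] := gsocle_hit szP oz (mem_cycle z p) ntz Sy.
  have [nsVG nsUG prVU] := chief_factor_context chVU.
  have nVz : <[z]> \subset 'N(V).
    exact: subset_trans szP (subset_trans sPG (normal_norm nsVG)).
  have [abUV _] := chief_pgroup_abelem chVU pUV.
  have: cyclic (U / V) by rewrite -defU quotientYidl // quotient_cyclic ?cycle_cyclic.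
  by rewrite (abelem_cyclic abUV) oUV pfactorK.
move=> Px; have /p_natP[k ox] := mem_p_elt pP Px.
case: k ox => [|[|k]] ox.
- by rewrite (eqP (_ : x == 1)) ?expg1n // -order_eq1 ox.
- by rewrite -[p]expn1 -ox expg_order.
have /eqP[] := no_p2 (x ^+ (p ^ k)) (groupX _ Px).
by rewrite (orderXexp _ ox) -addn2 addKn.
Qed.

Lemma Sylow_gsocle : gsocle G = P.
Proof.
apply/eqP; rewrite eqEsubset gsocle_subP; last exact: sub_minnormal_Sylow.
by apply/subsetP=> x Px; rewrite prime_order_gsocle ?Sylow_exponent.
Qed.

Lemma Sylow_normal : P <| G.
Proof. by rewrite -Sylow_gsocle gsocle_normal. Qed.

(** The centre of P is normal in G and meets every minimal normal subgroup, so it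
contains the socle. *)
Lemma Sylow_abelem : p.-abelem P.
Proof.
apply/abelemP=> //; split; last by move=> x; apply: Sylow_exponent.
have nZG : G \subset 'N('Z(P)).
  exact: char_norm_trans (center_char P) (normal_norm Sylow_normal).
have : P \subset 'Z(P).
  rewrite -{1}Sylow_gsocle; apply: gsocle_subP => N minN sNG.
  apply: (minnormal_sub minN nZG).
  have nsNP := normalS (sub_minnormal_Sylow minN sNG) sPG (minnormal_normal minN sNG).
  apply: meet_center_nil (pgroup_nil pP) nsNP _.
  by have /andP[] := mingroupp minN.
by rewrite subsetI subxx.
Qed.

Let abP : p.-abelem P := Sylow_abelem.

Lemma minnormal_decomposition : exists2 s : seq {group gT},
  {in s, forall V, minnormal V G /\ V \subset G}
  & \big[dprod/1]_(V <- s) (V : {set gT}) = P.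
Proof.
suff extend n : forall (E : {group gT}) s, E <| G -> E \subset P ->
    {in s, forall V, minnormal V G /\ V \subset G} ->
    \big[dprod/1]_(V <- s) (V : {set gT}) = E -> #|P| - #|E| < n ->
  exists2 s : seq {group gT}, {in s, forall V, minnormal V G /\ V \subset G}
    & \big[dprod/1]_(V <- s) (V : {set gT}) = P.
  by apply: (extend _ 1%G [::]) (ltnSn _); rewrite ?normal1 ?sub1G ?big_nil.
elim: n => // n IHn E s nsEG sEP mins defE lePEn.
have [eqEP | neEP] := eqVneq (gval E) (gval P); first by exists s; rewrite // defE.
have [N [minN sNG nsNE]] : exists N, [/\ minnormal N G, N \subset G & ~~ (N \subset E)].
  apply: gsocle_nsub; rewrite Sylow_gsocle.
  by apply: contra neEP => sPE; rewrite eqEsubset sEP.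
have sNP := sub_minnormal_Sylow minN sNG; have nsNG := minnormal_normal minN sNG.
have tiNE := minnormal_TI minN (normal_norm nsEG) nsNE.
have cNE : E \subset 'C(N) := sub_abelian_cent2 (abelem_abelian abP) sEP sNP.
apply: (IHn (N <*> E)%G (N :: s)).
- exact: normalY.
- by rewrite join_subG sNP.
- by move=> V; rewrite inE => /predU1P[-> | /mins].
- by rewrite big_cons defE dprodEY.
rewrite -ltnS; apply: leq_trans lePEn; rewrite ltnS.
apply: ltn_sub2l; apply: proper_card; rewrite properE.
  by rewrite sEP; apply: contra neEP => sPE; rewrite eqEsubset sEP.
by rewrite joing_subr join_subG subxx andbT.
Qed.

(** Apply [gsocle_hit] to K = <a, b>: both V1 and V2 are complements to V in U, and
f sends x in V1 to the element of V2 in the same coset of V.  If f a were in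
<[b]>, then a (f a)^-1 would be in K :&: V = 1 and a in V2. *)
Lemma minnormal_embedding V1 V2 a b : minnormal V1 G -> V1 \subset G ->
  minnormal V2 G -> V2 \subset G -> V1 :!=: V2 ->
  a \in V1 -> a != 1 -> b \in V2 -> b != 1 ->
  exists2 f, equivariant_embedding G V1 V2 f & f a \notin <[b]>.
Proof.
move=> min1 sV1G min2 sV2G ne12 Va nta Vb ntb.
have [ns1 ns2] := (minnormal_normal min1 sV1G, minnormal_normal min2 sV2G).
have [sV1P sV2P] := (sub_minnormal_Sylow min1 sV1G, sub_minnormal_Sylow min2 sV2G).
have ti12 : V1 :&: V2 = 1.
  apply: (minnormal_TI min1 (normal_norm ns2)); apply: contra ne12 => s12.
  by rewrite eqEcard s12 !card_minnormal ?leqnn.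
have [Pa Pb] := (subsetP sV1P a Va, subsetP sV2P b Vb).
have oa := abelem_order_p abP Pa nta; have ob := abelem_order_p abP Pb ntb.
have cab : <[b]> \subset 'C(<[a]>).
  by apply: sub_abelian_cent2 (abelem_abelian abP) _ _; rewrite cycle_subG.
pose K := (<[a]> <*> <[b]>)%G.
have sKP : K \subset P by rewrite join_subG !cycle_subG Pa.
have oK : #|K| = (p ^ 2)%N.
  rewrite /= cent_joinEr // TI_cardMg -?orderE ?oa ?ob //.
  by apply/trivgP; rewrite -ti12 setISS ?cycle_subG.
have Ka : a \in K by rewrite (subsetP (joing_subl _ _)) ?cycle_id.
have sbK : <[b]> \subset K by rewrite joing_subr.
have Kb : b \in K by rewrite -cycle_subG.
have Sa : a \in gsocle G by rewrite Sylow_gsocle.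
have [V [U [chVU [Ua V'a] _ defU tiKV]]] :=
  gsocle_hit sKP oK Ka nta Sa.
have [nsVG nsUG prVU] := chief_factor_context chVU.
have [_ tiV1V defU1 _] := minnormal_chief min1 sV1G chVU Va Ua V'a.
have Ub : b \in U by rewrite -defU (subsetP (joing_subr _ _)).
have V'b : b \notin V.
  apply: contra ntb => Vb'; rewrite -in_set1 -[[set 1]]/(1 : {set gT}) -tiKV.
  by rewrite inE Kb.
have [_ tiV2V defU2 _] := minnormal_chief min2 sV2G chVU Vb Ub V'b.
have sU1 : V1 \subset U by rewrite -defU1 mulG_subr.
have complV2 : V2 \in [complements to V in U].
  by apply/complP; rewrite setIC.
have nsVU : V <| U := normalS (proper_sub prVU) (normal_sub nsUG) nsVG.
exists (remgr V V2).
  split=> [x Vx | x y Vx Vy | x h Vx Gh | x Vx fx1].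
  - by rewrite mem_remgr // defU2 (subsetP sU1).
  - by apply: (remgrM complV2) => //; apply: (subsetP sU1).
  - have VV2x : x \in V * V2 by rewrite defU2 (subsetP sU1).
    rewrite {1}(divgr_eq V V2 x) conjMg remgrMid //; first by rewrite setIC.
      by rewrite memJ_norm ?mem_divgr // (subsetP (normal_norm nsVG)).
    by rewrite memJ_norm ?mem_remgr // (subsetP (normal_norm ns2)).
  have VV2x : x \in V * V2 by rewrite defU2 (subsetP sU1).
  have Vx' : x \in V by rewrite (divgr_eq V V2 x) fx1 mulg1 mem_divgr.
  by apply/set1P; rewrite -[[set 1]]/(1 : {set gT}) -tiV1V inE Vx.
apply/negP=> fab; have VV2a : a \in V * V2 by rewrite defU2.
have Kfa : remgr V V2 a \in K := subsetP sbK _ fab.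
have : divgr V V2 a \in K :&: V.
  by rewrite inE mem_divgr // andbT /divgr groupM ?groupV.
rewrite tiKV => /set1P d1; have := divgr_eq V V2 a; rewrite d1 mul1g => defa.
have : a \in V1 :&: V2 by rewrite inE Va defa mem_remgr.
by rewrite ti12 inE (negPf nta).
Qed.

Section Complement.

Variable H : {group gT}.
Hypotheses (sHG : H \subset G) (p'H : p^'.-group H) (defG : P * H = G).

Let nPG : G \subset 'N(P) := normal_norm Sylow_normal.

Lemma minnormal_complement V : minnormal V G -> V \subset G -> minnormal V H.
Proof.
move=> minV sVG; have [/andP[ntV nVG] minVV] := mingroupP minV.
apply/mingroupP; split=> [|X /andP[ntX nXH] sXV].
  by rewrite ntV (subset_trans sHG).
apply: minVV => //; rewrite ntX -defG mul_subG // cents_norm //.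
have sXP := subset_trans sXV (sub_minnormal_Sylow minV sVG).
by rewrite (sub_abelian_cent (abelem_abelian abP)).
Qed.

(** This centraliser is normalised by H and centralised by P, so it is a normal
p'-subgroup of G. *)
Lemma complement_cent_Sylow : 'C_H(P) = 1.
Proof.
apply/trivgP; rewrite -Op'G1; apply: pcore_max.
  exact: pgroupS (subsetIl _ _) p'H.
rewrite /normal subIset ?sHG // -defG mul_subG //.
  by rewrite cents_norm // centsC subsetIr.
by rewrite normsI ?normG // norms_cent // (subset_trans sHG).
Qed.

(** All minimal normal subgroups are equivariantly isomorphic, and they generate P. *)
Lemma complement_cent_minnormal V : minnormal V G -> V \subset G ->
  'C_H(V) = 1.
Proof.
move=> minV sVG; apply/trivgP; rewrite -complement_cent_Sylow subsetI subsetIl /=.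
rewrite centsC -Sylow_gsocle.
apply: gsocle_subP => N minN sNG.
have [<- | neVN] := eqVneq (gval V) (gval N); first by rewrite centsC subsetIr.
have [/andP[ntV _] _] := mingroupP minV; have [/andP[ntN _] _] := mingroupP minN.
have [[a Va nta] [b Nb ntb]] := (trivgPn _ ntV, trivgPn _ ntN).
have [f ef _] := minnormal_embedding minV sVG minN sNG neVN Va nta Nb ntb.
have [_ _ fJ _] := ef.
rewrite -(equivariant_image ef) ?card_minnormal //.
apply/centsP=> _ /imsetP[x Vx ->] h /setIP[Hh cVh].
apply/commgP/conjg_fixP; rewrite -fJ ?(subsetP sHG) //.
by rewrite conjgE -(centP cVh) // mulKg.
Qed.

(** V1 has an endomorphism phi that commutes with H and moves a outside <[a]>.  Each
h in H acts on V1 as a polynomial in phi, so H is abelian; it is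
faithful and irreducible on V1. *)
Lemma complement_cyclic V1 V2 : minnormal V1 G -> V1 \subset G ->
  minnormal V2 G -> V2 \subset G -> V1 :!=: V2 -> cyclic H.
Proof.
move=> min1 sV1G min2 sV2G ne12.
have [/andP[nt1 nV1G] _] := mingroupP min1; have [/andP[nt2 _] _] := mingroupP min2.
have [[a Va nta] [b Vb ntb]] := (trivgPn _ nt1, trivgPn _ nt2).
have [f ef _] := minnormal_embedding min1 sV1G min2 sV2G ne12 Va nta Vb ntb.
have [f12 _ _ f1] := ef.
have ntfa : f a != 1 by apply: contra nta => /eqP /(f1 _ Va) ->.
rewrite eq_sym in ne12.
have [g eg ga] := minnormal_embedding min2 sV2G min1 sV1G ne12 (f12 _ Va) ntfa Va nta.
(* The witness g is chosen with g (f a) outside <[a]>, so that phi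
   does not multiply a by a scalar. *)
have ephi := equivariant_comp nV1G ef eg; set phi := g \o f in ephi.
have [phiV phiM phiJ _] := ephi.
pose c := phi a; have Vc : c \in V1 by apply: phiV.
have ab1 : p.-abelem V1 := abelemS (sub_minnormal_Sylow min1 sV1G) abP.
have cV1 := abelem_abelian ab1.
have phiX x n : x \in V1 -> phi (x ^+ n) = phi x ^+ n.
  exact: equivariant_expg ephi x.
have defV1 : V1 :=: <[a]> * <[c]>.
  have sacV : <[a]> * <[c]> \subset V1 by rewrite mul_subG ?cycle_subG.
  apply/esym/eqP; rewrite eqEcard sacV (card_minnormal min1 sV1G).
  have oa := abelem_order_p ab1 Va nta.
  have ntc : c != 1 by apply: contraNneq ga => c1; rewrite -[g _]/c c1 group1.
  have oc := abelem_order_p ab1 Vc ntc.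
  have tiac : <[a]> :&: <[c]> = 1.
    by rewrite setIC prime_TIg -?orderE ?oc // cycle_subG.
  by rewrite TI_cardMg // -!orderE oa oc mulnn leqnn.
(* As h commutes with phi and V1 is generated by a and phi a, the action of
   h is determined by a ^ h: it is a polynomial in phi. *)
have act h : h \in H -> exists i j, {in V1, forall w, w ^ h = w ^+ i * phi w ^+ j}.
  move=> Hh; have Gh := subsetP sHG h Hh.
  have : a ^ h \in <[a]> * <[c]> by rewrite -defV1 memJ_norm ?(subsetP nV1G).
  case/mulsgP=> _ _ /cycleP[i ->] /cycleP[j ->] ah; exists i, j.
  have ch : c ^ h = c ^+ i * phi c ^+ j.
    by rewrite /c -phiJ // ah phiM ?groupX // !phiX.
  move=> w; rewrite defV1 => /mulsgP[_ _ /cycleP[k ->] /cycleP[l ->] ->].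
  rewrite phiM ?groupX // !phiX // conjMg !conjXg ah ch.
  have cV x y : x \in V1 -> y \in V1 -> commute x y by move=> ? ?; apply: (centsP cV1).
  have Vcc := phiV _ Vc.
  rewrite !expgMn; try by apply: cV; rewrite ?groupX.
  rewrite -!expgM !(mulnC k) !(mulnC l) !expgM.
  rewrite -!mulgA; congr (_ * _); rewrite !mulgA; congr (_ * _).
  by apply: cV; rewrite !groupX.
have abH : abelian H.
  apply/centsP=> x Hx y Hy; apply/commgP; rewrite -in_set1.
  rewrite -[[set 1]]/(1 : {set gT}) -(complement_cent_minnormal min1 sV1G).
  rewrite inE groupR //=.
  have nV1 := subset_trans sHG nV1G.
  have xyE w : w \in V1 -> w ^ (x * y) = w ^ (y * x).
    move=> Vw; have [[i [j actx]] [k [l acty]]] := (act x Hx, act y Hy).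
    rewrite !conjgM actx // conjMg !conjXg -phiJ ?(subsetP sHG) //.
    by rewrite -actx // memJ_norm // (subsetP nV1).
  apply/centP=> w Vw; apply/commute_sym/commgP/conjg_fixP.
  have Vw' : w ^ (y * x)^-1 \in V1 by rewrite memJ_norm // groupV (subsetP nV1) // groupM.
  by have := xyE _ Vw'; rewrite (commgC x y) [_ ^ (_ * [~ x, y])]conjgM !conjgKV.
have nV1H := subset_trans sHG nV1G.
pose rV := abelem_repr ab1 nt1 nV1H.
apply: (@mx_faithful_irr_abelian_cyclic _ _ _ _ rV) => //.
  exact/abelem_mx_faithful/complement_cent_minnormal.
exact/abelem_mx_irrP/minnormal_complement.
Qed.

End Complement.

End NoNormalOrderP.

End PartialPi.

(** * The structure theorem *)

Theorem theoremA (p : nat) (gT : finGroupType) (G P : {group gT})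
    (p_pr : prime p) (sylP : p.-Sylow(G) P)
    (Op'G1 : 'O_p^'(G) = 1) (leP : (p ^ 2 <= #|P|)%N)
    (PiP : forall K : {group gT},
       K \subset P -> #|K| = (p ^ 2)%N -> partial_Pi K G) :
  P :=: 'O_p(G) /\
  exists H : {group gT},
    [/\ p^'.-Hall(G) H,
        P ><| H = G
      & [\/ p_supersoluble p G,
            minnormal P G /\ #|P| = (p ^ 2)%N
          | [/\ (p ^ 4 <= #|P|)%N,
                cyclic H
              & exists (s : nat) (V : 'I_s -> {group gT})
                  (abelV : forall i, p.-abelem (V i))
                  (ntV : forall i, V i :!=: 1)
                  (nVH : forall i, H \subset 'N(V i)),
                  let rV i := abelem_repr (abelV i) (ntV i) (nVH i) in
                  [/\ (2 <= s)%N,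
                      \big[dprod/1]_(i < s) V i = P,
                      forall i, mx_irreducible (rV i),
                      forall i, 'dim (V i) = 2
                    & forall i j, mx_rsim (rV i) (rV j)]]]].
Proof.
pose has_normal_p := [exists N : {group gT}, (N <| G) && (#|N| == p)].
have nsPG : P <| G.
  have [/existsP[N /andP[nsNG /eqP oN]] | no_p] := boolP has_normal_p.
    by case: (prime_normal_supersoluble p_pr sylP Op'G1 PiP nsNG oN).
  apply: (Sylow_normal p_pr sylP Op'G1 PiP leP) => N nsNG.
  by apply: contra no_p => oN; apply/existsP; exists N; rewrite nsNG.
split; first by rewrite (normal_Hall_pcore sylP nsPG).
have [H compH] := splitsP (SchurZassenhaus_split (pHall_Hall sylP) nsPG).
have hallH : p^'.-Hall(G) H by rewrite -(compl_pHall _ sylP).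
have defG : P ><| H = G.
  have /complP[tiPH mulPH] := compH; rewrite sdprodE //.
  by rewrite (subset_trans _ (normal_norm nsPG)) // -mulPH mulG_subr.
exists H; split=> //.
have [/existsP[N /andP[nsNG /eqP oN]] | no_p] := boolP has_normal_p.
  by constructor 1; case: (prime_normal_supersoluble p_pr sylP Op'G1 PiP nsNG oN).
have no_normal_p (N : {group gT}) : N <| G -> #|N| != p.
  by move=> nsNG; apply: contra no_p => oN; apply/existsP; exists N; rewrite nsNG.
have [s mins defP] := minnormal_decomposition p_pr sylP Op'G1 PiP leP no_normal_p.
have minN_card := card_minnormal p_pr sylP Op'G1 PiP leP no_normal_p.
have minN_sub := sub_minnormal_Sylow p_pr sylP Op'G1 PiP leP.
have abP := Sylow_abelem p_pr sylP Op'G1 PiP leP no_normal_p.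
case: s => [|V0 [|V1 s]] in mins defP *.
- rewrite big_nil in defP; move: leP.
  by rewrite -defP cards1 leqNgt -(expn0 p) ltn_exp2l ?prime_gt1.
- have [minV0 sV0G] := mins V0 (mem_head _ _).
  have eqV0 : V0 = P by apply: val_inj; rewrite /= -defP big_seq1.
  by constructor 2; rewrite -eqV0 minN_card.
constructor 3.
have [_ sHG mulPH nPH _] := sdprod_context defG.
have [minV0 sV0G] := mins V0 (mem_head _ _).
have [minV1 sV1G] : minnormal V1 G /\ V1 \subset G by apply: mins; rewrite !inE eqxx orbT.
have p'H := pHall_pgroup hallH.
have [neV01 leP4] : V0 :!=: V1 /\ p ^ 4 <= #|P|.
  move: defP; rewrite !big_cons => /dprodP[[_ R _ defR] defP _ tiV0R].
  rewrite defR in defP tiV0R.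
  have [[_ R' _ defR'] defR1 _ tiV1R'] := dprodP defR.
  rewrite defR' in defR1 tiV1R'.
  split.
    have /mingroupp/andP[ntV0 _] := minV0.
    apply: contra ntV0 => /eqP eqV01; rewrite -subG1 -tiV0R subsetI subxx /=.
    by rewrite eqV01 -defR1 mulG_subl.
  rewrite -defP TI_cardMg // -defR1 TI_cardMg //.
  rewrite (minN_card V0) // (minN_card V1) // mulnA -(expnD p 2 2).
  by rewrite leq_pmulr ?cardG_gt0.
split=> //.
  exact: (complement_cyclic p_pr sylP Op'G1 PiP leP no_normal_p sHG p'H mulPH
    minV0 sV0G minV1 sV1G neV01).
pose V (i : 'I_(size [:: V0, V1 & s])) := nth 1%G [:: V0, V1 & s] i.
have minV i : minnormal (V i) G /\ V i \subset G by apply: mins; apply: mem_nth.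
have abV i : p.-abelem (V i) by apply: abelemS abP; have [] := minV i; apply: minN_sub.
have ntV i : V i :!=: 1 by have [/mingroupp/andP[]] := minV i.
have nVH i : H \subset 'N(V i).
  by have [/mingroupp/andP[_ nV] _] := minV i; apply: subset_trans nV.
exists _, V, abV, ntV, nVH; split=> //= [|i|i|i j].
- by rewrite -defP (big_nth 1%G) big_mkord.
- apply/abelem_mx_irrP; have [] := minV i.
  exact: (minnormal_complement p_pr sylP Op'G1 PiP leP no_normal_p sHG mulPH).
- rewrite (dim_abelemE (abV i) (ntV i)); have [? ?] := minV i.
  by rewrite minN_card // pfactorK.
have [[mini sViG] [minj sVjG]] := (minV i, minV j).
have oij : #|V i| = #|V j| by rewrite !minN_card.
have [f ef] : exists f, equivariant_embedding G (V i) (V j) f.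
  have [<- | neij] := eqVneq (gval (V i)) (gval (V j)).
    by exists id; apply: equivariant_id.
  have [[a Va nta] [b Vb ntb]] := (trivgPn _ (ntV i), trivgPn _ (ntV j)).
  have [f ef _] := minnormal_embedding p_pr sylP Op'G1 PiP leP no_normal_p
    mini sViG minj sVjG neij Va nta Vb ntb.
  by exists f.
apply: (equivariant_rsim _ _ _ _ _ _ (f := f)) => //.
have [f1 f2 f3 f4] := ef; split=> // x h Vx Hh.
by rewrite f3 ?(subsetP sHG).
Qed.
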